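(* Among shapes $\Psi\in\mathfrak F$ (normalized so that $B^2_\Psi=1$), the only function which satisfies the conditions $B^n_\Psi=0$ for all $n>2$ is the MNS shape $\psi(t)=\dfrac1{1+e^t}$, $t\in\mathbb R$.
   Context: $\mathfrak F$ is the set of (differentiable) functions $\Psi:\mathbb R\to[0,1]$ such that $\Psi'\le 0$ is Riemann integrable, $\Psi\in L^1(0,\infty)$ and $1-\Psi\in L^1(-\infty,0)$. For $\Psi\in\mathfrak F$ put $\Phi=-\Psi'$. By definition $B^1_\Psi=0$, and for $n\ge2$, $$B^n_\Psi=\sum_{k=0}^{n-1}b^n_k\int_{\mathbb R}x\Phi(x)\Psi(x)^k(1-\Psi(x))^{n-1-k}dx,\qquad b^n_k=\sum_{l=1}^{k+1}(-1)^{l+1}\binom{n-l}{k+1-l}\sum_{\substack{m_1,\dots,m_l\ge1\\ m_1+\dots+m_l=n}}\frac{n!}{m_1!\cdots m_l!}.$$ In particular $B^2_\Psi=\int_{\mathbb R}\Psi(x)(1-\Psi(x))\,dx$.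
   Formalization: All B^n with n≥2 are translation invariant, so every translate ψ(t−a) also satisfies the conditions; the formal statement says the solutions are exactly the translates of the MNS shape, with ψ itself the only one when ∫xΦ(x)dx=0. *)

(* Defs.v *)
From Stdlib Require Import Reals Lra Lia List Arith FinFun.
From Coquelicot Require Import Coquelicot.
Import ListNotations.
Open Scope R_scope.

Definition is_RInt_line (f : R -> R) (v : R) : Prop :=
  is_RInt_gen f (Rbar_locally m_infty) (Rbar_locally p_infty) v.

Definition ex_RInt_line (f : R -> R) : Prop :=
  exists v, is_RInt_line f v.

Definition RInt_line (f : R -> R) : R :=
  RInt_gen f (Rbar_locally m_infty) (Rbar_locally p_infty).

(* The set frak F.  Convergence of an improper Riemann integral over an
   unbounded interval includes Riemann integrability on bounded subintervals.
   Since Psi is continuous with values in [0,1], membership of Psi in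
   L^1(0,oo) and of 1 - Psi in L^1(-oo,0) is the convergence of the
   corresponding improper integrals of nonnegative functions. *)
Record shape (Psi : R -> R) : Prop := {
  shape_range : forall x, 0 <= Psi x <= 1;
  shape_derivable : forall x, ex_derive Psi x;
  shape_derive_le0 : forall x, Derive Psi x <= 0;
  shape_derive_RInt : ex_RInt_line (Derive Psi);
  shape_L1_right : ex_RInt_gen Psi (at_point 0) (Rbar_locally p_infty);
  shape_L1_left :
    ex_RInt_gen (fun x => 1 - Psi x) (Rbar_locally m_infty) (at_point 0)
}.

Definition density (Psi : R -> R) (x : R) : R := - Derive Psi x.

(* The compositions of n into l positive parts; see [compositionsP]
   and [compositions_NoDup]. *)
Fixpoint compositions (l n : nat) : list (list nat) :=
  match l with
  | O => match n with O => [[]] | S _ => [] end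
  | S l' =>
      flat_map (fun m => map (cons m) (compositions l' (n - m))) (seq 1 n)
  end.

Definition multinomial (n : nat) (ms : list nat) : R :=
  INR (fact n) / fold_right (fun m p => INR (fact m) * p) 1 ms.

Definition sum_multinomial (l n : nat) : R :=
  fold_right Rplus 0 (map (multinomial n) (compositions l n)).

(* [Binomial.C] is the binomial coefficient; plain [C] is Coquelicot's type of
   complex numbers.  Only used for k < n, so that no nat subtraction truncates. *)
Definition bcoef (n k : nat) : R :=
  sum_n_m (fun l => (-1) ^ (l + 1) * Binomial.C (n - l) (k + 1 - l)
                    * sum_multinomial l n) 1 (k + 1).

(* [Bcoef Psi n] is B^n_Psi for n >= 1; the value at n = 0 is junk.  For a
   shape Psi all the integrals involved converge absolutely. *)
Definition Bcoef (Psi : R -> R) (n : nat) : R :=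
  match n with
  | 0%nat | 1%nat => 0
  | _ =>
      sum_n_m (fun k => bcoef n k *
        RInt_line (fun x => x * density Psi x * Psi x ^ k
                            * (1 - Psi x) ^ (n - 1 - k))) 0 (n - 1)
  end.

(* The mean of the probability density -Psi', which is what the formula for
   B^n_Psi would give at n = 1. *)
Definition mean (Psi : R -> R) : R := RInt_line (fun x => x * density Psi x).

Definition MNS (t : R) : R := 1 / (1 + exp t).

Lemma compositionsP l n ms :
  In ms (compositions l n) <->
  length ms = l /\ List.Forall (fun m => (1 <= m)%nat) ms /\ list_sum ms = n.
Proof.
revert n ms; induction l as [|l IH]; intros n ms; simpl.
- destruct n; simpl; split.
  + intros [<-|[]]; auto.
  + intros [H _]; left; destruct ms; [auto|discriminate].
  + tauto.
  + intros [H [_ H2]]; destruct ms; simpl in *; discriminate.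
- rewrite in_flat_map; split.
  + intros [m [Hm H]]; apply in_map_iff in H; destruct H as [ms' [<- H]].
    apply IH in H; apply in_seq in Hm; destruct H as [H1 [H2 H3]].
    simpl; repeat split; [lia|constructor; [lia|exact H2]|].
    change (fold_right Nat.add 0%nat ms') with (list_sum ms') in *; lia.
  + destruct ms as [|m ms]; intros [H1 [H2 H3]]; [discriminate|].
    inversion H2; subst m; subst.
    simpl in *; change (fold_right Nat.add 0%nat ms) with (list_sum ms) in *.
    exists x; rewrite in_seq; split; [lia|].
    apply in_map; apply IH; repeat split; [lia|assumption|lia].
Qed.

Lemma compositions_NoDup l n : NoDup (compositions l n).
Proof.
revert n; induction l as [|l IH]; intros n; simpl.
- destruct n; repeat constructor; simpl; tauto.
- generalize (seq_NoDup n 1); induction (seq 1 n) as [|m s IHs]; simpl.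
  + constructor.
  + intros Hs; inversion Hs; subst; apply NoDup_app; [|auto|].
    * apply FinFun.Injective_map_NoDup; [|apply IH].
      intros a b E; injection E; auto.
    * intros ms H; apply in_map_iff in H; destruct H as [ms' [<- _]].
      rewrite in_flat_map; intros [m' [Hm' H]].
      apply in_map_iff in H; destruct H as [? [E _]].
      injection E; intros; subst; contradiction.
Qed.

(* Main.v *)
Require Import Defs.
From Stdlib Require Import Reals Lra Lia List Arith ClassicalEpsilon FunctionalExtensionality.
From Coquelicot Require Import Coquelicot.
Open Scope R_scope.

(** Write [p = Psi x].  Summing over [k], the coefficients [b^n_k] assemble in the
    Bernstein basis to a polynomial [P_n] with [P_1 = 1] and
    [P_(n+1) = (p (1 - p) P_n)'] (recurrence of the surjection numbers), so an
    integration by parts gives [B^(n+1) = int Psi (1 - Psi) P_n(Psi) dx].  The [P_n]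
    span all polynomials, and [int_0^1 P_n = 0] for [n > 1]; hence the conditions say
    that [Psi] pushes [Psi (1 - Psi) dx] forward to Lebesgue measure on [0, 1].
    Approximating indicators of intervals by polynomials, this gives
    [int_x^y Psi (1 - Psi) = Psi x - Psi y], i.e. the logistic equation
    [Psi' = - Psi (1 - Psi)], whose solutions are the translates of [MNS]; the mean
    of the translate by [a] is [a]. *)

(** [Derive Psi] may be discontinuous: it is only Riemann integrable. Integration by parts therefore
    rests on [RInt_FTC] and [ex_RInt_mult_continuous]. The boundary terms vanish because an antitone
    integrable function is o(1/x); the left end is reduced to the right one by the symmetry taking
    [Psi x] to [1 - Psi (- x)]. The polynomial approximation supplies only upper bounds: the mass of
    [Psi (1 - Psi) dx] to the right of [x] is at most [Psi x], the mass to the left at most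
    [1 - Psi x]. Since the total mass is 1, both are equalities. The values B^n with n > 1 do not
    change under translation of [Psi], so a condition on the mean is what singles out [MNS] among
    its translates. *)

(** * Riemann integrals with a discontinuous factor *)

(* Choosing the evaluation points by the mean value theorem makes every Riemann
   sum of [f] equal to [F b - F a]. *)
Lemma RInt_FTC (F f : R -> R) (a b : R) :
  a <= b -> (forall x, is_derive F x (f x)) -> ex_RInt f a b ->
  RInt f a b = F b - F a.
Proof.
intros Hab HF [v Hv].
rewrite (is_RInt_unique _ _ _ _ Hv).
destruct (Rle_lt_or_eq_dec a b Hab) as [Hlt | <-].
2: { rewrite <- (is_RInt_unique _ _ _ _ Hv), RInt_point; unfold zero; simpl; ring. }
assert (MVT : forall x y : R, exists c,
  (x <= y -> x <= c <= y) /\ F y - F x = f c * (y - x)).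
{ intros x y.
  destruct (MVT_gen F x y f) as [c [Hc E]].
  - intros; apply HF.
  - intros; apply continuity_pt_filterlim, (@ex_derive_continuous _ R_NormedModule); eexists; apply HF.
  - exists c; split; [|exact E].
    intros Hxy; rewrite Rmin_left, Rmax_right in Hc; lra. }
set (pt := fun x y => proj1_sig (constructive_indefinite_description _ (MVT x y))).
assert (Hpt : forall x y, (x <= y -> x <= pt x y <= y) /\ F y - F x = f (pt x y) * (y - x)).
{ intros x y; unfold pt; destruct constructive_indefinite_description; auto. }
assert (Hsum : forall s h, Riemann_sum f (SF_seq_f2 pt (h :: s)) = F (seq.last h s) - F h).
{ induction s as [|k s IH]; intros h.
  - unfold Riemann_sum; simpl; unfold zero; simpl; ring.
  - rewrite SF_cons_f2 by (simpl; lia).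
    rewrite Riemann_sum_cons, IH; simpl.
    unfold plus, scal; simpl; unfold mult; simpl.
    destruct (Hpt h k) as [_ E].
    replace (F (seq.last k s) - F h) with ((F k - F h) + (F (seq.last k s) - F k)) by ring.
    rewrite E; ring. }
apply Rminus_diag_uniq, NNPP; intros Hne.
set (e := Rabs (v - (F b - F a))).
assert (He : 0 < e) by (apply Rabs_pos_lt; exact Hne).
destruct (Hv (ball v (mkposreal e He)) (locally_ball _ _)) as [d Hd].
destruct (nfloor_ex ((b - a) / d)) as [n [_ Hn]].
{ apply Rlt_le, Rdiv_lt_0_compat; [lra|apply cond_pos]. }
destruct (Riemann_fine_unif_part pt a b n) as [S1 [S2 [S3 S4]]]; [intros; apply Hpt; lra|lra|].
assert (Hstep : seq_step (SF_lx (SF_seq_f2 pt (unif_part a b n))) < d).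
{ eapply Rle_lt_trans; [exact S1|].
  pose proof (cond_pos d); pose proof (pos_INR n).
  apply Rlt_div_l in Hn; [|lra]; apply Rlt_div_l; [lra|].
  rewrite Rmult_comm; exact Hn. }
specialize (Hd _ Hstep).
rewrite Rmin_left, Rmax_right in Hd by lra.
specialize (Hd (conj S2 (conj S3 S4))).
assert (E : Riemann_sum f (SF_seq_f2 pt (unif_part a b n)) = F b - F a).
{ pose proof (last_unif_part 0 a b n) as L; pose proof (head_unif_part 0 a b n) as H0.
  destruct (unif_part a b n) as [|h s] eqn:Eu; [discriminate Eu|].
  rewrite Hsum; simpl in H0, L; rewrite H0 in *; rewrite L; reflexivity. }
rewrite sign_eq_1 in Hd by lra.
replace (Riemann_sum f _) with (F b - F a) in Hd by (symmetry; exact E).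
change (Rabs (1 * (F b - F a) - v) < e) in Hd.
rewrite Rmult_1_l, Rabs_minus_sym in Hd; unfold e in Hd; lra.
Qed.

(** [g] is a step function, available by uniform continuity of [G]; on each step [f * g] is a scalar
    multiple of [f], hence integrable. *)
Lemma step_approx (f G : R -> R) (a b : R) (eps : R) :
  0 < eps -> a <= b -> ex_RInt f a b ->
  (forall x, a <= x <= b -> continuous G x) ->
  exists g : R -> R, (forall x, a <= x <= b -> Rabs (G x - g x) <= eps) /\
    ex_RInt (fun x => f x * g x) a b.
Proof.
intros Heps Hab Hf HG.
destruct (unifcont_1d G a b HG (mkposreal eps Heps)) as [d Hd].
assert (Hd2 : forall x y, a <= x <= b -> a <= y <= b -> Rabs (x - y) < d -> Rabs (G x - G y) <= eps).
{ intros x y Hx Hy Hxy; apply Rnot_lt_le; intros Hn; apply (Hd x y Hx Hy).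
  - rewrite Rabs_minus_sym in Hxy; exact Hxy.
  - intros B; change (Rabs (G y - G x) < eps) in B.
    rewrite Rabs_minus_sym in Hn; lra. }
assert (Hdp := cond_pos d).
(* Sweep to the right in strides of [d / 2]: the last stride [[c', c]], cut off at [a], is shorter
   than the modulus [d], so the constant [G c] serves there. *)
assert (Ind : forall k c, a <= c <= b -> c - a <= INR k * (d / 2) ->
  exists g : R -> R, (forall x, a <= x <= c -> Rabs (G x - g x) <= eps) /\
    ex_RInt (fun x => f x * g x) a c).
{ induction k as [|k IH]; intros c Hc Hk.
  - simpl in Hk; replace c with a by lra.
    exists G; split; [|apply ex_RInt_point].
    intros; rewrite Rminus_diag, Rabs_R0; lra.
  - rewrite S_INR in Hk.
    set (c' := Rmax a (c - d / 2)).
    assert (Hc' : a <= c' <= c /\ c - d / 2 <= c')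
      by (unfold c'; repeat split; [apply Rmax_l|apply Rmax_lub; lra|apply Rmax_r]).
    destruct (IH c') as [g [Hg1 Hg2]].
    + lra.
    + unfold c'; pose proof (pos_INR k); apply Rmax_case; [|lra].
      rewrite Rminus_diag; apply Rmult_le_pos; lra.
    + exists (fun x => if Rle_dec x c' then g x else G c); split.
      * intros x Hx; destruct (Rle_dec x c'); [apply Hg1; lra|].
        apply Hd2; try lra.
        apply Rabs_lt_between; lra.
      * apply ex_RInt_Chasles with c'.
        -- eapply ex_RInt_ext; [|exact Hg2].
           intros x; rewrite Rmin_left, Rmax_right by lra; intros Hx; simpl.
           destruct (Rle_dec x c'); [reflexivity|lra].
        -- apply ex_RInt_ext with (fun x => scal (G c) (f x)).
           ++ intros x; rewrite Rmin_left, Rmax_right by lra; intros Hx; simpl.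
              unfold scal; simpl; unfold mult; simpl.
              destruct (Rle_dec x c'); [lra|ring].
           ++ apply (@ex_RInt_scal R_NormedModule).
              apply (@ex_RInt_Chasles_1 R_CompleteNormedModule) with b; [lra|].
              apply (@ex_RInt_Chasles_2 R_CompleteNormedModule) with a; [lra|exact Hf]. }
destruct (nfloor_ex ((b - a) / (d / 2))) as [n [_ Hn]].
{ apply Rle_div_r; lra. }
apply (Ind (S n) b); [lra|].
rewrite S_INR; apply Rlt_div_l in Hn; lra.
Qed.

(** As [f] is bounded, the products of [f] with step functions tending uniformly to [G] converge
    uniformly, and a uniform limit of integrable functions is integrable. *)
Lemma ex_RInt_mult_continuous (f G : R -> R) (a b : R) :
  a <= b -> ex_RInt f a b ->
  (forall x, a <= x <= b -> continuous G x) ->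
  ex_RInt (fun x => f x * G x) a b.
Proof.
intros Hab Hf HG.
destruct (ex_RInt_ub f a b Hf) as [M HM].
rewrite Rmin_left, Rmax_right in HM by lra.
assert (HM' : forall t, a <= t <= b -> Rabs (f t) <= Rabs M + 1).
{ intros t Ht; specialize (HM t Ht); unfold norm in HM; simpl in HM; unfold abs in HM; simpl in HM.
  pose proof (Rle_abs M); lra. }
assert (HM0 : 0 < Rabs M + 1) by (pose proof (Rabs_pos M); lra).
set (M' := Rabs M + 1) in *.
assert (A : forall n : nat, exists g : R -> R,
  (forall x, a <= x <= b -> Rabs (G x - g x) <= / (INR n + 1)) /\ ex_RInt (fun x => f x * g x) a b).
{ intros n; apply step_approx; auto.
  apply Rinv_0_lt_compat; pose proof (pos_INR n); lra. }
set (g := fun n => proj1_sig (constructive_indefinite_description _ (A n))).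
assert (Hg : forall n, (forall x, a <= x <= b -> Rabs (G x - g n x) <= / (INR n + 1))
  /\ ex_RInt (fun x => f x * g n x) a b).
{ intros n; unfold g; destruct constructive_indefinite_description; auto. }
(* [filterlim_RInt] asks for uniform convergence on all of R, so outside [[a, b]] the approximants
   are set equal to the limit. *)
set (h := fun n x => if Rle_dec a x then if Rle_dec x b then f x * g n x else f x * G x else f x * G x).
destruct (@filterlim_RInt nat R_CompleteNormedModule h a b eventually _
  (fun x => f x * G x) (fun n => RInt (h n) a b)) as [If [_ HIf]].
- intros n; apply RInt_correct.
  apply ex_RInt_ext with (fun x => f x * g n x); [|apply Hg].
  intros x; rewrite Rmin_left, Rmax_right by lra; intros Hx; unfold h.
  destruct (Rle_dec a x); [|lra]; destruct (Rle_dec x b); [reflexivity|lra].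
- apply filterlim_locally; intros eps.
  destruct (nfloor_ex (M' / eps)) as [n [_ Hn]].
  { apply Rlt_le, Rdiv_lt_0_compat; [lra|apply cond_pos]. }
  exists n; intros k Hk x.
  change (Rabs (h k x - f x * G x) < eps).
  pose proof (cond_pos eps).
  assert (Z : forall u, Rabs (u - u) < eps) by (intros; rewrite Rminus_diag, Rabs_R0; lra).
  unfold h; destruct (Rle_dec a x); [destruct (Rle_dec x b)|]; try apply Z.
  replace (f x * g k x - f x * G x) with (- (f x * (G x - g k x))) by ring.
  rewrite Rabs_Ropp, Rabs_mult.
  destruct (Hg k) as [Hgk _]; specialize (Hgk x (conj r r0)); specialize (HM' x (conj r r0)).
  assert (INR n <= INR k) by (apply le_INR; exact Hk).
  pose proof (pos_INR n).
  apply Rle_lt_trans with (M' * / (INR k + 1)).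
  + apply Rmult_le_compat; try apply Rabs_pos; assumption.
  + apply Rlt_div_l; [lra|]; apply Rlt_div_l in Hn; nra.
- exists If; exact HIf.
Qed.

(** * Surjection numbers and the polynomials [Bpoly] *)

Lemma sum_n_Rext (f g : nat -> R) (n : nat) :
  (forall k, (k <= n)%nat -> f k = g k) -> sum_n f n = sum_n g n.
Proof. apply (sum_n_ext_loc (G := R_AbelianMonoid)). Qed.

Lemma sum_n_Rmult_l (c : R) (f : nat -> R) (n : nat) :
  c * sum_n f n = sum_n (fun k => c * f k) n.
Proof. symmetry; apply (sum_n_mult_l (K := R_Ring)). Qed.

Lemma sum_n_Rplus (f g : nat -> R) (n : nat) :
  sum_n f n + sum_n g n = sum_n (fun k => f k + g k) n.
Proof. symmetry; apply (sum_n_plus (G := R_AbelianMonoid)). Qed.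

Lemma sum_n_RS (f : nat -> R) (n : nat) : sum_n f (S n) = sum_n f n + f (S n).
Proof. apply (sum_Sn (G := R_AbelianMonoid)). Qed.

Lemma sum_n_Rfirst (f : nat -> R) (n : nat) :
  sum_n f (S n) = f 0%nat + sum_n (fun k => f (S k)) n.
Proof.
unfold sum_n; rewrite (sum_Sn_m (G := R_AbelianMonoid)) by lia.
rewrite <- (sum_n_m_S (G := R_AbelianMonoid)); reflexivity.
Qed.

(** The coefficient of z^n in the product of exp z with the power series of coefficients [a]. *)
Definition egf_conv (a : nat -> R) (n : nat) : R :=
  sum_n (fun m => / INR (fact m) * a (n - m)%nat) n.

(** The coefficient of z^n in (exp z - 1)^l; [sum_multinomial l n] counts the surjections from n
    points onto l points. *)
Definition surj_coef (l n : nat) : R := sum_multinomial l n / INR (fact n).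

Lemma INR_fact_pos n : 0 < INR (fact n).
Proof. apply lt_0_INR, lt_O_fact. Qed.

(** The product rule for exp z times a power series, read off coefficientwise: the weight [S n]
    splits as [m + (S n - m)]. *)
Lemma egf_conv_derive (a : nat -> R) (n : nat) :
  INR (S n) * egf_conv a (S n) =
  egf_conv a n + egf_conv (fun i => INR (S i) * a (S i)) n.
Proof.
assert (E : INR (S n) * egf_conv a (S n) =
  sum_n (fun m => INR m * / INR (fact m) * a (S n - m)%nat) (S n)
  + sum_n (fun m => / INR (fact m) * (INR (S n - m) * a (S n - m)%nat)) (S n)).
{ unfold egf_conv; rewrite sum_n_Rmult_l, sum_n_Rplus.
  apply sum_n_Rext; intros m Hm.
  rewrite (minus_INR (S n) m) by lia; ring. }
rewrite E; f_equal.
- unfold egf_conv; rewrite sum_n_Rfirst.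
  change (INR 0) with 0; rewrite !Rmult_0_l, Rplus_0_l.
  apply sum_n_Rext; intros m Hm.
  change (S n - S m)%nat with (n - m)%nat; change (fact (S m)) with (S m * fact m)%nat.
  rewrite mult_INR.
  pose proof (INR_fact_pos m); pose proof (pos_INR m); rewrite S_INR; field.
  split; nra.
- rewrite sum_n_RS, Nat.sub_diag; change (INR 0) with 0.
  rewrite Rmult_0_l, Rmult_0_r, Rplus_0_r.
  apply sum_n_Rext; intros m Hm.
  rewrite Nat.sub_succ_l by lia; reflexivity.
Qed.

Lemma surj_coef_0_S n : surj_coef 0 (S n) = 0.
Proof. unfold surj_coef, sum_multinomial; simpl; unfold Rdiv; ring. Qed.

Lemma surj_coef_compositions l n :
  surj_coef l n = fold_right Rplus 0
    (map (fun ms => / fold_right (fun m p => INR (fact m) * p) 1 ms) (compositions l n)).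
Proof.
unfold surj_coef, sum_multinomial.
induction (compositions l n) as [|ms L IH]; simpl.
- unfold Rdiv; ring.
- rewrite <- IH; unfold multinomial; pose proof (INR_fact_pos n); unfold Rdiv.
  rewrite Rmult_plus_distr_r; f_equal.
  rewrite Rmult_comm, <- Rmult_assoc, Rinv_l, Rmult_1_l by lra; reflexivity.
Qed.

Lemma fold_right_Rplus_app (L M : list R) :
  fold_right Rplus 0 (L ++ M) = fold_right Rplus 0 L + fold_right Rplus 0 M.
Proof. induction L as [|x L IH]; simpl; [ring|rewrite IH; ring]. Qed.

(** Multiplication by exp z - 1: the first part [m] of a composition is at least 1, so the term
    [m = 0] of the convolution has to be subtracted. *)
Lemma surj_coef_S l n :
  surj_coef (S l) n = egf_conv (surj_coef l) n - surj_coef l n.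
Proof.
transitivity (fold_right Rplus 0 (map (fun m => / INR (fact m) * surj_coef l (n - m)) (seq 1 n))).
- rewrite surj_coef_compositions; simpl.
  induction (seq 1 n) as [|m s IH]; simpl; [reflexivity|].
  rewrite map_app, fold_right_Rplus_app, IH; f_equal.
  rewrite surj_coef_compositions.
  induction (compositions l (n - m)) as [|ms L IH']; simpl; [ring|].
  rewrite IH', Rinv_mult; ring.
- unfold egf_conv; set (f := fun m => / INR (fact m) * surj_coef l (n - m)).
  assert (E : surj_coef l n = f O) by (unfold f; rewrite Nat.sub_0_r; simpl; field).
  rewrite E; clearbody f; clear E.
  induction n as [|n IH]; [rewrite sum_O; simpl; ring|].
  rewrite seq_S, map_app, fold_right_Rplus_app, IH, sum_n_RS.
  simpl; ring.
Qed.

(* In terms of the exponential generating function [(exp z - 1)^l] this is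
   [d/dz (exp z - 1)^l = l ((exp z - 1)^l + (exp z - 1)^(l-1))]. *)
Lemma surj_coef_rec l n :
  INR (S n) * surj_coef l (S n) = INR l * (surj_coef l n + surj_coef (pred l) n).
Proof.
revert n; induction l as [|l IH]; intros n.
- rewrite surj_coef_0_S; simpl; ring.
- rewrite surj_coef_S, Rmult_minus_distr_l, egf_conv_derive, IH.
  replace (egf_conv (fun i => INR (S i) * surj_coef l (S i)) n)
    with (INR l * (egf_conv (surj_coef l) n + egf_conv (surj_coef (pred l)) n)).
  2: { unfold egf_conv.
       rewrite sum_n_Rplus, sum_n_Rmult_l.
       apply sum_n_Rext; intros m _; rewrite IH; ring. }
  simpl pred.
  (* For [l = 0] the factor [INR l] kills both sides, so the junk value [pred 0 = 0] is harmless. *)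
  assert (E : INR l * (egf_conv (surj_coef (pred l)) n - surj_coef (pred l) n)
    = INR l * surj_coef l n).
  { destruct l as [|l]; [simpl; ring|].
    simpl pred; rewrite <- surj_coef_S; reflexivity. }
  rewrite surj_coef_S, S_INR; nra.
Qed.

(** Removing one of the [S n] points, whose image is one of [l] values, leaves a surjection onto all
    [l] values or onto the other [l - 1]. *)
Lemma sum_multinomial_rec l n :
  sum_multinomial l (S n) = INR l * (sum_multinomial l n + sum_multinomial (pred l) n).
Proof.
pose proof (surj_coef_rec l n) as H; unfold surj_coef in H.
pose proof (INR_fact_pos n); pose proof (INR_fact_pos (S n)).
assert (E : INR (fact (S n)) = INR (S n) * INR (fact n)) by (rewrite <- mult_INR; reflexivity).
rewrite E in H.
assert (0 < INR (S n)) by (apply lt_0_INR; lia).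
apply (Rmult_eq_compat_r (INR (fact n))) in H.
field_simplify in H; try lra; rewrite H; field.
Qed.

Lemma sum_multinomial_lt l n : (n < l)%nat -> sum_multinomial l n = 0.
Proof.
revert l; induction n as [|n IH]; intros l Hl.
- destruct l; [lia|reflexivity].
- rewrite sum_multinomial_rec, !IH by lia; ring.
Qed.

Lemma sum_multinomial_diag n : sum_multinomial n n <> 0.
Proof.
induction n as [|n IH].
- unfold sum_multinomial, multinomial; simpl; lra.
- rewrite sum_multinomial_rec, sum_multinomial_lt by lia; simpl pred.
  rewrite Rplus_0_l; apply Rmult_integral_contrapositive; split; [apply not_0_INR; lia|exact IH].
Qed.

(* [Bpoly n] is the polynomial [P] with B^(n+1) = int x Phi P(Psi) dx. *)
Definition Bpoly (n : nat) (p : R) : R :=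
  sum_n (fun j => (-1) ^ j * sum_multinomial (S j) (S n) * p ^ j) n.

Lemma sum_n_triangle (u : nat -> nat -> R) (n : nat) :
  sum_n (fun k => sum_n (fun j => u j k) k) n =
  sum_n (fun j => sum_n (fun i => u j (j + i)%nat) (n - j)) n.
Proof.
induction n as [|n IH]; [rewrite !sum_O; reflexivity|].
rewrite !sum_n_RS, IH, Nat.sub_diag, sum_O, Nat.add_0_r, <- Rplus_assoc.
f_equal; rewrite sum_n_Rplus.
apply sum_n_Rext; intros j Hj.
rewrite (Nat.sub_succ_l j n), sum_n_RS by lia; do 2 f_equal; lia.
Qed.

(** With [l = j + 1] and the summations exchanged, the terms of a fixed [j] add up to p^j (p + (1 -
    p))^(n - j) = p^j by the binomial theorem. *)
Lemma bcoef_Bernstein (n : nat) (p : R) :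
  sum_n (fun k => bcoef (S n) k * (p ^ k * (1 - p) ^ (n - k))) n = Bpoly n p.
Proof.
transitivity (sum_n (fun k => sum_n (fun j => (-1) ^ j * sum_multinomial (S j) (S n)
  * Binomial.C (n - j) (k - j) * (p ^ k * (1 - p) ^ (n - k))) k) n).
- apply sum_n_Rext; intros k Hk; unfold bcoef.
  replace (k + 1)%nat with (S k) by lia.
  rewrite <- sum_n_m_S.
  change (sum_n_m ?f 0 k) with (sum_n f k).
  rewrite Rmult_comm, sum_n_Rmult_l.
  apply sum_n_Rext; intros j _.
  replace (S j + 1)%nat with (S (S j)) by lia; simpl; ring.
- rewrite sum_n_triangle; unfold Bpoly; apply sum_n_Rext; intros j Hj.
  transitivity ((-1) ^ j * sum_multinomial (S j) (S n) * p ^ j *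
    (sum_n (fun i => Binomial.C (n - j) i * p ^ i * (1 - p) ^ (n - j - i)) (n - j))).
  + rewrite sum_n_Rmult_l; apply sum_n_Rext; intros i Hi.
    replace (j + i - j)%nat with i by lia.
    replace (n - (j + i))%nat with (n - j - i)%nat by lia.
    rewrite pow_add; ring.
  + rewrite sum_n_Reals, <- binomial.
    replace (p + (1 - p)) with 1 by ring; rewrite pow1; ring.
Qed.

Lemma Bpoly_0 p : Bpoly 0 p = 1.
Proof.
unfold Bpoly; rewrite sum_O; unfold sum_multinomial, multinomial; simpl; field.
Qed.

(** The coefficient of p^j in the derivative is (j + 1)(c_j - c_(j-1)), which the surjection
    recurrence, with the alternating signs, identifies with that of [Bpoly (S n)]. *)
Lemma Bpoly_derive (n : nat) (p : R) :
  is_derive (fun q => q * (1 - q) * Bpoly n q) p (Bpoly (S n) p).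
Proof.
set (c := fun j => (-1) ^ j * sum_multinomial (S j) (S n)).
apply is_derive_ext with (fun q => sum_n (fun j => c j * (q ^ (S j) - q ^ (S (S j)))) n).
{ intros q; unfold Bpoly.
  rewrite sum_n_Rmult_l; apply sum_n_Rext; intros j _; unfold c; simpl; ring. }
set (d := fun j => c j * (INR (S j) * p ^ j - INR (S (S j)) * p ^ (S j))).
replace (Bpoly (S n) p) with (sum_n d n).
{ apply (@is_derive_sum_n R_AbsRing R_NormedModule); intros j _; unfold d.
  auto_derive; [trivial|].
  change (pred (S j)) with j; change (pred (S (S j))) with (S j).
  simpl; ring. }
(* Collecting equal powers in [d] telescopes up to a single term of degree [m + 1]. *)
assert (A : forall m, sum_n (fun j => INR (S j) *
    (c j - match j with O => 0 | S i => c i end) * p ^ j) m =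
  sum_n d m + INR (S (S m)) * c m * p ^ (S m) :> R).
{ induction m as [|m IH].
  - rewrite !sum_O; unfold d; simpl; ring.
  - rewrite !sum_n_RS, IH; unfold d; rewrite !S_INR; simpl; ring. }
(* This allows summation up to [S n], the degree of [Bpoly (S n)], and cancels the leftover term of
   [A]. *)
assert (Z : c (S n) = 0).
{ unfold c; rewrite sum_multinomial_lt by lia; ring. }
assert (E : sum_n d n = sum_n d (S n) + INR (S (S (S n))) * c (S n) * p ^ (S (S n)) :> R).
{ rewrite sum_n_RS; unfold d at 3; rewrite Z; lra. }
rewrite E, <- A; unfold Bpoly; apply sum_n_Rext; intros j _.
rewrite (sum_multinomial_rec (S j) (S n)); unfold c; destruct j as [|j]; simpl pred.
- rewrite (sum_multinomial_rec 0); simpl; ring.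
- simpl; ring.
Qed.

(** * Improper integrals *)

Lemma is_RInt_gen_comp_opp (Fa Fb Ga Gb : (R -> Prop) -> Prop) (f : R -> R) (v : R) :
  filterlim Ropp Gb Fa -> filterlim Ropp Ga Fb ->
  is_RInt_gen f Fa Fb v -> is_RInt_gen (fun x => f (- x)) Ga Gb v.
Proof.
intros Ha Hb H P HP; destruct (H P HP) as [Q T HQ HT HQT].
exists (fun x => T (- x)) (fun y => Q (- y)); [apply Hb, HT|apply Ha, HQ|].
intros x y Hx Hy; simpl; destruct (HQT _ _ Hy Hx) as [u [Hu1 Hu2]]; simpl in Hu1.
exists u; split; [|exact Hu2].
apply is_RInt_swap in Hu1.
apply is_RInt_ext with (fun t => opp (opp (f (- t)))); [intros; apply opp_opp|].
rewrite <- (opp_opp u); apply (@is_RInt_opp R_NormedModule).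
apply (@is_RInt_comp_opp R_NormedModule); exact Hu1.
Qed.

Lemma filterlim_opp_p : filterlim Ropp (Rbar_locally p_infty) (Rbar_locally m_infty).
Proof. apply (filterlim_Rbar_opp p_infty). Qed.

Lemma filterlim_opp_m : filterlim Ropp (Rbar_locally m_infty) (Rbar_locally p_infty).
Proof. apply (filterlim_Rbar_opp m_infty). Qed.

Lemma filterlim_opp_0 : filterlim Ropp (at_point 0) (at_point 0).
Proof. intros P HP; unfold filtermap, at_point in *; rewrite Ropp_0; exact HP. Qed.

Lemma ex_RInt_gen_opp_right (f : R -> R) :
  ex_RInt_gen f (Rbar_locally m_infty) (at_point 0) ->
  ex_RInt_gen (fun x => f (- x)) (at_point 0) (Rbar_locally p_infty).
Proof.
intros [v Hv]; exists v; revert Hv; apply is_RInt_gen_comp_opp;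
  [apply filterlim_opp_p|apply filterlim_opp_0].
Qed.

Lemma ex_RInt_gen_opp_left (f : R -> R) :
  ex_RInt_gen f (at_point 0) (Rbar_locally p_infty) ->
  ex_RInt_gen (fun x => f (- x)) (Rbar_locally m_infty) (at_point 0).
Proof.
intros [v Hv]; exists v; revert Hv; apply is_RInt_gen_comp_opp;
  [apply filterlim_opp_0|apply filterlim_opp_m].
Qed.

(** Restricting to the symmetric intervals [[-N, N]] replaces the limit in two endpoints by the
    limit of a sequence. *)
Lemma is_RInt_line_lim_seq (f : R -> R) (v : R) :
  is_RInt_line f v -> is_lim_seq (fun n => RInt f (- INR n) (INR n)) v.
Proof.
intros H P HP; destruct (H P HP) as [Q T [A HA] [B HB] HQT].
destruct (nfloor_ex (Rmax 0 (Rmax (- A) B))) as [n [_ Hn]]; [apply Rmax_l|].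
exists (S n); intros k Hk.
assert (Hk' : INR n + 1 <= INR k) by (rewrite <- S_INR; apply le_INR; exact Hk).
pose proof (Rmax_l (- A) B); pose proof (Rmax_r (- A) B); pose proof (Rmax_r 0 (Rmax (- A) B)).
destruct (HQT (- INR k) (INR k)) as [u [Hu1 Hu2]]; [apply HA; lra|apply HB; lra|].
simpl in Hu1; rewrite (is_RInt_unique _ _ _ _ Hu1); exact Hu2.
Qed.

Lemma ex_RInt_line_ex_RInt (f : R -> R) (a b : R) :
  a <= b -> ex_RInt_line f -> ex_RInt f a b.
Proof.
intros Hab [v H]; destruct (H (fun _ => True) filter_true) as [Q T [A HA] [B HB] HQT].
destruct (HQT (Rmin A a - 1) (Rmax B b + 1)) as [u [Hu _]].
- apply HA; pose proof (Rmin_l A a); lra.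
- apply HB; pose proof (Rmax_l B b); lra.
- simpl in Hu; pose proof (Rmin_r A a); pose proof (Rmax_r B b).
  apply (@ex_RInt_Chasles_1 R_CompleteNormedModule) with (Rmax B b + 1); [lra|].
  apply (@ex_RInt_Chasles_2 R_CompleteNormedModule) with (Rmin A a - 1); [lra|].
  exists u; exact Hu.
Qed.

(** The partial integrals increase with the endpoint, so they converge to their supremum [l]. *)
Lemma ex_RInt_gen_pos_bounded (f : R -> R) (M : R) :
  (forall b, 0 <= b -> ex_RInt f 0 b) -> (forall x, 0 <= x -> 0 <= f x) ->
  (forall b, 0 <= b -> RInt f 0 b <= M) ->
  ex_RInt_gen f (at_point 0) (Rbar_locally p_infty).
Proof.
intros Hex Hpos HM.
destruct (completeness (fun y => exists b, 0 <= b /\ y = RInt f 0 b)) as [l [Hl1 Hl2]].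
{ exists M; intros y [b [Hb ->]]; auto. }
{ exists (RInt f 0 0), 0; split; [lra|reflexivity]. }
assert (Hmono : forall a b, 0 <= a <= b -> RInt f 0 a <= RInt f 0 b).
{ intros a b Hab.
  assert (E1 : ex_RInt f a b).
  { apply (@ex_RInt_Chasles_2 R_CompleteNormedModule) with 0; [lra|apply Hex; lra]. }
  rewrite <- (RInt_Chasles f 0 a b); [|apply Hex; lra|exact E1].
  assert (0 <= RInt f a b) by (apply RInt_ge_0; [lra|exact E1|intros; apply Hpos; lra]).
  change (RInt f 0 a <= RInt f 0 a + RInt f a b); lra. }
exists l; intros P [e He].
assert (Hb0 : exists b0, 0 <= b0 /\ l - e < RInt f 0 b0).
{ apply NNPP; intros Hn; pose proof (cond_pos e).
  assert (l <= l - e); [|lra].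
  apply Hl2; intros y [b [Hb ->]]; apply Rnot_lt_le; intros Hlt; apply Hn; exists b; auto. }
destruct Hb0 as [b0 [Hb0 Hb1]].
exists (fun x => x = 0) (fun y => b0 < y); [reflexivity|exists b0; auto|].
intros x y -> Hy; simpl; exists (RInt f 0 y); split.
- apply (@RInt_correct R_CompleteNormedModule), Hex; lra.
- apply He; change (Rabs (RInt f 0 y - l) < e).
  assert (RInt f 0 y <= l) by (apply Hl1; exists y; split; [lra|reflexivity]).
  assert (RInt f 0 b0 <= RInt f 0 y) by (apply Hmono; lra).
  rewrite Rabs_left1; lra.
Qed.

Lemma RInt_le_gen_pos (f : R -> R) :
  (forall x, 0 <= x -> 0 <= f x) ->
  ex_RInt_gen f (at_point 0) (Rbar_locally p_infty) ->
  exists M, forall b, 0 <= b -> ex_RInt f 0 b /\ RInt f 0 b <= M.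
Proof.
intros Hpos [v H]; destruct (H (ball v (mkposreal 1 Rlt_0_1)) (locally_ball _ _))
  as [Q T HQ [B HB] HQT].
exists (v + 1); intros b Hb.
destruct (HQT 0 (Rmax B b + 1)) as [u [Hu1 Hu2]]; [exact HQ|apply HB; pose proof (Rmax_l B b); lra|].
pose proof (Rmax_r B b); simpl in Hu1.
assert (E : ex_RInt f 0 (Rmax B b + 1)) by (exists u; exact Hu1).
assert (E1 : ex_RInt f 0 b).
{ apply (@ex_RInt_Chasles_1 R_CompleteNormedModule) with (Rmax B b + 1); [lra|exact E]. }
assert (E2 : ex_RInt f b (Rmax B b + 1)).
{ apply (@ex_RInt_Chasles_2 R_CompleteNormedModule) with 0; [lra|exact E]. }
split; [exact E1|].
pose proof (RInt_Chasles f _ _ _ E1 E2) as C.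
rewrite (is_RInt_unique _ _ _ _ Hu1) in C.
assert (0 <= RInt f b (Rmax B b + 1)) by (apply RInt_ge_0; [lra|exact E2|intros; apply Hpos; lra]).
change (RInt f 0 b + RInt f b (Rmax B b + 1) = u) in C.
change (Rabs (u - v) < 1) in Hu2; apply Rabs_def2 in Hu2; lra.
Qed.

(** Monotonicity gives [b / 2 * f b <= RInt f (b / 2) b], and the right side tends to 0 by the
    Cauchy criterion. *)
Lemma antitone_integrable_tail (f : R -> R) :
  (forall x, 0 <= f x) -> (forall x y, x <= y -> f y <= f x) ->
  ex_RInt_gen f (at_point 0) (Rbar_locally p_infty) ->
  is_lim_seq (fun n => INR n * f (INR n)) 0.
Proof.
intros Hpos Hdec Hex; apply is_lim_seq_spec; intros e; pose proof (cond_pos e) as He.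
destruct Hex as [v H].
(* The integrals up to [b] and up to [b / 2] are both within [e / 4] of [v]; doubling their
   difference gives [e]. The factor 2 in front of [Rmax 0 B] below keeps [b / 2] beyond [B]. *)
assert (He4 : 0 < e / 4) by lra.
destruct (H (ball v (mkposreal _ He4)) (locally_ball _ _)) as [Q T HQ [B HB] HQT].
destruct (nfloor_ex (2 * Rmax 0 B)) as [n [_ Hn]]; [pose proof (Rmax_l 0 B); lra|].
exists (S n); intros k Hk.
assert (Hk' : INR n + 1 <= INR k) by (rewrite <- S_INR; apply le_INR; exact Hk).
pose proof (Rmax_l 0 B); pose proof (Rmax_r 0 B).
set (b := INR k) in *.
destruct (HQT 0 b) as [u [Hu1 Hu2]]; [exact HQ|apply HB; lra|].
destruct (HQT 0 (b / 2)) as [w [Hw1 Hw2]]; [exact HQ|apply HB; lra|].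
simpl in Hu1, Hw1.
assert (E2 : ex_RInt f (b / 2) b).
{ apply (@ex_RInt_Chasles_2 R_CompleteNormedModule) with 0; [lra|exists u; exact Hu1]. }
pose proof (RInt_Chasles f 0 (b / 2) b (ex_intro _ _ Hw1) E2) as C.
rewrite (is_RInt_unique _ _ _ _ Hu1), (is_RInt_unique _ _ _ _ Hw1) in C.
change (w + RInt f (b / 2) b = u) in C.
assert (L : b / 2 * f b <= RInt f (b / 2) b).
{ transitivity (RInt (fun _ => f b) (b / 2) b).
  - rewrite RInt_const; unfold scal; simpl; unfold mult; simpl; lra.
  - apply RInt_le; [lra|apply ex_RInt_const|exact E2|intros; apply Hdec; lra]. }
change (Rabs (u - v) < e / 4) in Hu2; change (Rabs (w - v) < e / 4) in Hw2.
apply Rabs_def2 in Hu2; apply Rabs_def2 in Hw2.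
assert (0 <= b * f b) by (apply Rmult_le_pos; [lra|apply Hpos]).
rewrite Rminus_0_r, Rabs_pos_eq by assumption; lra.
Qed.

(** * Shapes: reflection, tails and integration by parts *)

Lemma shape_is_derive (Psi : R -> R) (HPsi : shape Psi) (x : R) : is_derive Psi x (Derive Psi x).
Proof. apply Derive_correct, (shape_derivable _ HPsi). Qed.

Lemma shape_continuous (Psi : R -> R) (HPsi : shape Psi) (x : R) : continuous Psi x.
Proof. apply (@ex_derive_continuous _ R_NormedModule), (shape_derivable _ HPsi). Qed.

Lemma shape_antitone (Psi : R -> R) (HPsi : shape Psi) (x y : R) : x <= y -> Psi y <= Psi x.
Proof.
intros Hxy; destruct (MVT_gen Psi x y (Derive Psi)) as [c [_ E]].
- intros; apply (shape_is_derive _ HPsi).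
- intros; apply continuity_pt_filterlim, (shape_continuous _ HPsi).
- pose proof (shape_derive_le0 _ HPsi c); nra.
Qed.

Lemma shape_ex_RInt_Derive (Psi : R -> R) (HPsi : shape Psi) (a b : R) : a <= b -> ex_RInt (Derive Psi) a b.
Proof. intros; apply ex_RInt_line_ex_RInt; [assumption|apply HPsi]. Qed.

Lemma shape_Derive_opp (Psi : R -> R) (HPsi : shape Psi) (x : R) : Derive (fun y => 1 - Psi (- y)) x = Derive Psi (- x).
Proof.
apply is_derive_unique; auto_derive; [apply (shape_derivable _ HPsi)|].
change (- (- (1) * Derive Psi (- x)) = Derive Psi (- x)); ring.
Qed.

(** The reflection exchanges the two integrability conditions; through it, statements about the left
    half-line follow from those about the right one. *)
Lemma shape_opp (Psi : R -> R) (HPsi : shape Psi) : shape (fun x => 1 - Psi (- x)).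
Proof.
split.
- intros x; pose proof (shape_range _ HPsi (- x)); lra.
- intros x; auto_derive; apply (shape_derivable _ HPsi).
- intros x; rewrite (shape_Derive_opp _ HPsi); apply HPsi.
- destruct (shape_derive_RInt _ HPsi) as [v Hv]; exists v; unfold is_RInt_line in *.
  apply is_RInt_gen_ext with (fun x => Derive Psi (- x)).
  + apply filter_forall; intros ab x _; symmetry; apply (shape_Derive_opp _ HPsi).
  + revert Hv; apply is_RInt_gen_comp_opp; [apply filterlim_opp_p|apply filterlim_opp_m].
- apply (ex_RInt_gen_opp_right (fun x => 1 - Psi x)), HPsi.
- apply ex_RInt_gen_ext with (fun x => Psi (- x)).
  + apply filter_forall; intros ab x _; change (Psi (- x) = 1 - (1 - Psi (- x))); ring.
  + apply ex_RInt_gen_opp_left, HPsi.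
Qed.

Lemma shape_tail_right (Psi : R -> R) (HPsi : shape Psi) : is_lim_seq (fun n => INR n * Psi (INR n)) 0.
Proof.
apply antitone_integrable_tail; [|intros; apply (shape_antitone _ HPsi); assumption|apply HPsi].
intros; apply (shape_range _ HPsi).
Qed.

Lemma shape_tail_left (Psi : R -> R) :
  shape Psi -> is_lim_seq (fun n => INR n * (1 - Psi (- INR n))) 0.
Proof. intros H; apply (shape_tail_right _ (shape_opp _ H)). Qed.

Lemma is_lim_seq_0_of_INR_mult (u : nat -> R) :
  is_lim_seq (fun n => INR n * u n) 0 -> is_lim_seq u 0.
Proof.
intros H.
apply is_lim_seq_ext_loc with (fun n => / INR n * (INR n * u n)).
- exists 1%nat; intros n Hn; field; apply not_0_INR; lia.
- replace (Finite 0) with (Rbar_mult 0 0) by (simpl; f_equal; ring).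
  apply is_lim_seq_mult'; [|exact H].
  replace (Finite 0) with (Rbar_inv p_infty) by reflexivity.
  apply is_lim_seq_inv; [apply is_lim_seq_INR|discriminate].
Qed.

Lemma ex_RInt_x_density (Psi r : R -> R) (a b : R) :
  shape Psi -> a <= b -> (forall p, continuous r p) ->
  ex_RInt (fun x => x * density Psi x * r (Psi x)) a b.
Proof.
intros HPsi Hab Hr.
apply ex_RInt_ext with (fun x => Derive Psi x * (- x * r (Psi x))).
{ intros x _; unfold density; change (Derive Psi x * (- x * r (Psi x)) = x * - Derive Psi x * r (Psi x)); ring. }
apply ex_RInt_mult_continuous; [exact Hab|apply shape_ex_RInt_Derive; assumption|].
intros x _; apply (continuous_mult (fun x => - x)).
- apply (@continuous_opp _ R_AbsRing R_NormedModule), continuous_id.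
- apply continuous_comp; [apply shape_continuous; exact HPsi|apply Hr].
Qed.

(** Integration by parts: [- x * Q (Psi x)] is an antiderivative of [x * density Psi x * q (Psi x) -
    Q (Psi x)]. *)
Lemma RInt_x_density (Psi Q q : R -> R) (a b : R) :
  shape Psi -> a <= b ->
  (forall p, is_derive Q p (q p)) -> (forall p, continuous q p) ->
  RInt (fun x => x * density Psi x * q (Psi x)) a b =
  a * Q (Psi a) - b * Q (Psi b) + RInt (fun x => Q (Psi x)) a b.
Proof.
intros HPsi Hab HQ Hq.
assert (HQc : forall x, continuous (fun x => Q (Psi x)) x).
{ intros x; apply continuous_comp; [apply shape_continuous; exact HPsi|].
  apply (@ex_derive_continuous _ R_NormedModule); eexists; apply HQ. }
assert (E1 := ex_RInt_x_density Psi q a b HPsi Hab Hq).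
assert (E2 : ex_RInt (fun x => Q (Psi x)) a b).
{ apply (@ex_RInt_continuous R_CompleteNormedModule); auto. }
assert (E : RInt (fun x => x * density Psi x * q (Psi x) - Q (Psi x)) a b =
  - b * Q (Psi b) - - a * Q (Psi a)).
{ apply (RInt_FTC (fun x => - x * Q (Psi x))); [exact Hab| |].
  - intros x.
    replace (x * density Psi x * q (Psi x) - Q (Psi x)) with
      (- (1) * Q (Psi x) + - x * (Derive Psi x * q (Psi x))) by (unfold density; ring).
    apply (is_derive_mult (fun x => - x) (fun x => Q (Psi x))).
    + apply (@is_derive_opp _ R_NormedModule), (@is_derive_id R_AbsRing).
    + apply (is_derive_comp Q Psi); [apply HQ|apply shape_is_derive; exact HPsi].
    + intros; apply Rmult_comm.
  - apply (@ex_RInt_minus R_NormedModule); assumption. }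
rewrite (RInt_minus (V := R_CompleteNormedModule)) in E by assumption.
change (RInt (fun x => x * density Psi x * q (Psi x)) a b - RInt (fun x => Q (Psi x)) a b =
  - b * Q (Psi b) - - a * Q (Psi a)) in E; lra.
Qed.

Lemma continuous_pow_mult (k m : nat) (p : R) : continuous (fun p => p ^ k * (1 - p) ^ m) p.
Proof.
apply (@ex_derive_continuous _ R_NormedModule); auto_derive; trivial.
Qed.

Lemma pow_mult_bounds (k m : nat) (p : R) : 0 <= p <= 1 -> 0 <= p ^ k * (1 - p) ^ m <= 1.
Proof.
intros Hp.
assert (A : forall y i, 0 <= y <= 1 -> 0 <= y ^ i <= 1).
{ intros y i Hy; split; [apply pow_le; lra|rewrite <- (pow1 i); apply pow_incr; lra]. }
pose proof (A p k Hp); pose proof (A (1 - p) m ltac:(lra)).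
split; [apply Rmult_le_pos; lra|].
nra.
Qed.

(** The integrand lies between 0 and [x * density Psi x], whose integral over [[0, b]] is, by parts,
    that of [Psi] minus [b * Psi b], hence bounded. *)
Lemma ex_RInt_gen_x_density_right (Psi : R -> R) (k m : nat) :
  shape Psi ->
  ex_RInt_gen (fun x => x * density Psi x * (Psi x ^ k * (1 - Psi x) ^ m))
    (at_point 0) (Rbar_locally p_infty).
Proof.
intros HPsi.
assert (HF : forall x, 0 <= x -> 0 <= x * density Psi x).
{ intros x Hx; apply Rmult_le_pos; [exact Hx|]; unfold density.
  pose proof (shape_derive_le0 _ HPsi x); lra. }
assert (HR := shape_range _ HPsi).
assert (Hex : forall b, 0 <= b ->
  ex_RInt (fun x => x * density Psi x * (Psi x ^ k * (1 - Psi x) ^ m)) 0 b).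
{ intros b Hb; apply (ex_RInt_x_density Psi (fun p => p ^ k * (1 - p) ^ m)); auto.
  apply continuous_pow_mult. }
destruct (RInt_le_gen_pos Psi) as [M HM]; [intros; apply HR|apply HPsi|].
apply ex_RInt_gen_pos_bounded with M; [exact Hex| |].
- intros x Hx; apply Rmult_le_pos; [auto|apply pow_mult_bounds, HR].
- intros b Hb; apply Rle_trans with (RInt (fun x => x * density Psi x * 1) 0 b).
  + apply RInt_le; [exact Hb|auto| |].
    * apply (ex_RInt_x_density Psi (fun _ => 1)); auto; intros; apply continuous_const.
    * intros x Hx; apply Rmult_le_compat_l; [apply HF; lra|apply pow_mult_bounds, HR].
  + rewrite (RInt_x_density Psi (fun p => p) (fun _ => 1)); auto.
    * destruct (HM b Hb) as [_ H]; assert (0 <= b * Psi b) by (apply Rmult_le_pos; [lra|apply HR]).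
      change (RInt (fun x => Psi x) 0 b) with (RInt Psi 0 b); lra.
    * intros; apply (@is_derive_id R_AbsRing).
    * intros; apply continuous_const.
Qed.

Lemma ex_RInt_line_x_density (Psi : R -> R) (k m : nat) :
  shape Psi ->
  ex_RInt_line (fun x => x * density Psi x * (Psi x ^ k * (1 - Psi x) ^ m)).
Proof.
intros HPsi.
destruct (ex_RInt_gen_x_density_right Psi k m HPsi) as [v Hv].
assert (L : ex_RInt_gen (fun x => x * density Psi x * (Psi x ^ k * (1 - Psi x) ^ m))
    (Rbar_locally m_infty) (at_point 0)).
(* Reflection turns [Psi] into [1 - Psi], so the exponents [k] and [m] trade places. *)
{ destruct (ex_RInt_gen_opp_left _
    (ex_RInt_gen_x_density_right _ m k (shape_opp _ HPsi))) as [w Hw].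
  apply (@is_RInt_gen_opp R_NormedModule) in Hw; try apply _.
  exists (opp w); revert Hw; apply is_RInt_gen_ext.
  apply filter_forall; intros ab x _; unfold density; rewrite shape_Derive_opp by assumption.
  rewrite Ropp_involutive.
  change (- (- x * - Derive Psi x * ((1 - Psi x) ^ m * (1 - (1 - Psi x)) ^ k)) =
    x * - Derive Psi x * (Psi x ^ k * (1 - Psi x) ^ m)).
  replace (1 - (1 - Psi x)) with (Psi x) by ring; ring. }
destruct L as [w Hw]; exists (plus w v); unfold is_RInt_line.
apply (@is_RInt_gen_Chasles R_NormedModule) with 0; assumption || apply _.
Qed.

Lemma is_lim_seq_RInt_line (Psi : R -> R) (k m : nat) :
  shape Psi ->
  is_lim_seq (fun N => RInt (fun x => x * density Psi x * (Psi x ^ k * (1 - Psi x) ^ m))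
    (- INR N) (INR N))
    (RInt_line (fun x => x * density Psi x * (Psi x ^ k * (1 - Psi x) ^ m))).
Proof.
intros HPsi; apply is_RInt_line_lim_seq; unfold is_RInt_line, RInt_line.
apply (@RInt_gen_correct R_CompleteNormedModule); try apply _.
apply ex_RInt_line_x_density, HPsi.
Qed.

Lemma INR_interval N : - INR N <= INR N.
Proof. pose proof (pos_INR N); lra. Qed.

Lemma Bpoly_continuous n p : continuous (Bpoly n) p.
Proof.
unfold Bpoly; apply (@ex_derive_continuous _ R_NormedModule).
eexists; apply (@is_derive_sum_n R_AbsRing R_NormedModule).
intros k _; apply Derive_correct; auto_derive; trivial.
Qed.

Lemma bounded_on_unit (f : R -> R) :
  (forall p, continuous f p) -> exists M, 0 <= M /\ forall p, 0 <= p <= 1 -> Rabs (f p) <= M.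
Proof.
intros Hf.
destruct (ex_RInt_ub f 0 1) as [M HM].
{ apply (@ex_RInt_continuous R_CompleteNormedModule); auto. }
rewrite Rmin_left, Rmax_right in HM by lra.
exists M; split; [|exact HM].
eapply Rle_trans; [apply Rabs_pos|apply (HM 0); lra].
Qed.

(** The factor [1 - Psi] at the left end and [Psi] at the right end beat the factor [INR N]; the
    rest is bounded. *)
Lemma shape_boundary_lim (Psi f : R -> R) :
  shape Psi -> (forall p, continuous f p) ->
  is_lim_seq (fun N => - INR N * (Psi (- INR N) * (1 - Psi (- INR N)) * f (Psi (- INR N)))
    - INR N * (Psi (INR N) * (1 - Psi (INR N)) * f (Psi (INR N)))) 0.
Proof.
intros HPsi Hf; destruct (bounded_on_unit f Hf) as [M [HM0 HM]].
assert (HR := shape_range _ HPsi).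
apply is_lim_seq_abs_0.
apply is_lim_seq_le_le with (u := fun _ => 0)
  (w := fun N => M * (INR N * (1 - Psi (- INR N))) + M * (INR N * Psi (INR N))).
- intros N; split; [apply Rabs_pos|].
  assert (HN := pos_INR N).
  assert (A : forall x y p, 0 <= y -> 0 <= p <= 1 -> x = p \/ x = 1 - p -> Rabs (y * (p * (1 - p) * f p)) <= M * (y * x)).
  { intros x y p Hy Hp Hx.
    rewrite !Rabs_mult, (Rabs_pos_eq y), (Rabs_pos_eq p), (Rabs_pos_eq (1 - p)) by lra.
    replace (M * (y * x)) with (y * (x * M)) by ring.
    apply Rmult_le_compat_l; [exact Hy|].
    apply Rmult_le_compat; [nra|apply Rabs_pos|destruct Hx; subst; nra|auto]. }
  eapply Rle_trans; [apply Rabs_triang|].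
  rewrite <- Ropp_mult_distr_l, !Rabs_Ropp.
  apply Rplus_le_compat; apply A; auto.
- apply is_lim_seq_const.
- replace (Finite 0) with (Finite (M * 0 + M * 0)) by (f_equal; ring).
  apply is_lim_seq_plus'; apply (is_lim_seq_scal_l _ M 0).
  + apply shape_tail_left, HPsi.
  + apply shape_tail_right, HPsi.
Qed.

Lemma is_lim_seq_RInt_sum (h : nat -> R -> R) (c v : nat -> R) (n : nat) :
  (forall k N, ex_RInt (h k) (- INR N) (INR N)) ->
  (forall k, is_lim_seq (fun N => RInt (h k) (- INR N) (INR N)) (v k)) ->
  is_lim_seq (fun N => RInt (fun x => sum_n (fun k => c k * h k x) n) (- INR N) (INR N))
    (sum_n (fun k => c k * v k) n).
Proof.
intros Hex Hlim.
assert (S1 : forall k N, ex_RInt (fun x => c k * h k x) (- INR N) (INR N)).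
{ intros k N; apply (@ex_RInt_scal R_NormedModule), Hex. }
assert (L1 : forall k, is_lim_seq (fun N => RInt (fun x => c k * h k x) (- INR N) (INR N)) (c k * v k)).
{ intros k; apply is_lim_seq_ext with (fun N => c k * RInt (h k) (- INR N) (INR N)).
  - intros N; symmetry; apply (RInt_scal (V := R_CompleteNormedModule)), Hex.
  - apply (is_lim_seq_scal_l _ (c k) (v k)), Hlim. }
assert (S2 : forall m N, ex_RInt (fun x => sum_n (fun k => c k * h k x) m) (- INR N) (INR N)).
{ induction m as [|m IH]; intros N.
  - eapply ex_RInt_ext; [|apply (S1 0%nat)]; intros; rewrite sum_O; reflexivity.
  - eapply ex_RInt_ext; [|apply (@ex_RInt_plus R_NormedModule); [apply IH|apply (S1 (S m))]].
    intros; rewrite sum_n_RS; reflexivity. }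
induction n as [|n IH].
- rewrite sum_O; eapply is_lim_seq_ext; [|apply L1].
  intros N; apply RInt_ext; intros; rewrite sum_O; reflexivity.
- rewrite sum_n_RS.
  eapply is_lim_seq_ext; [|apply is_lim_seq_plus'; [exact IH|apply L1]].
  intros N; simpl.
  transitivity (RInt (fun x => plus (sum_n (fun k => c k * h k x) n) (c (S n) * h (S n) x)) (- INR N) (INR N)).
  + symmetry; apply (RInt_plus (V := R_CompleteNormedModule)); auto.
  + apply RInt_ext; intros; rewrite sum_n_RS; reflexivity.
Qed.

(** By [bcoef_Bernstein] the defining sum is the integral of
    [x * density Psi x * Bpoly (S n) (Psi x)], and an antiderivative of [Bpoly (S n)] is
    [q * (1 - q) * Bpoly n q]: integrate by parts. *)
Lemma Bcoef_lim (Psi : R -> R) (n : nat) :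
  shape Psi ->
  is_lim_seq (fun N => RInt (fun x => Psi x * (1 - Psi x) * Bpoly n (Psi x)) (- INR N) (INR N))
    (Bcoef Psi (S (S n))).
Proof.
intros HPsi; set (m := S n).
set (h := fun k x => x * density Psi x * (Psi x ^ k * (1 - Psi x) ^ (m - k))).
assert (E : Bcoef Psi (S m) = sum_n (fun k => bcoef (S m) k * RInt_line (h k)) m).
{ unfold Bcoef, m at 1.
  replace (S m - 1)%nat with m by lia; apply sum_n_Rext; intros k _; f_equal.
  unfold RInt_line; apply f_equal3; try reflexivity.
  apply functional_extensionality; intros x; unfold h.
  match goal with |- ?u = ?v => change (u = v :> R) end; ring. }
fold m; rewrite E; clear E.
assert (L : is_lim_seq (fun N => RInt (fun x => sum_n (fun k => bcoef (S m) k * h k x) m)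
  (- INR N) (INR N)) (sum_n (fun k => bcoef (S m) k * RInt_line (h k)) m)).
{ apply is_lim_seq_RInt_sum.
  - intros k N; apply (ex_RInt_x_density Psi (fun p => p ^ k * (1 - p) ^ (m - k))); auto.
    + apply INR_interval.
    + apply continuous_pow_mult.
  - intros k; apply is_lim_seq_RInt_line, HPsi. }
pose proof (shape_boundary_lim Psi (Bpoly n) HPsi (Bpoly_continuous n)) as Bd.
eapply is_lim_seq_ext; [|rewrite <- (Rminus_0_r (sum_n _ _)); apply is_lim_seq_minus'; [exact L|exact Bd]].
intros N; simpl.
assert (E : RInt (fun x => sum_n (fun k => bcoef (S m) k * h k x) m) (- INR N) (INR N) =
  RInt (fun x => x * density Psi x * Bpoly m (Psi x)) (- INR N) (INR N)).
{ apply RInt_ext; intros x _; rewrite <- bcoef_Bernstein, sum_n_Rmult_l.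
  apply sum_n_Rext; intros k _; unfold h; ring. }
rewrite E, (RInt_x_density Psi (fun q => q * (1 - q) * Bpoly n q)); auto.
- ring.
- apply INR_interval.
- intros p; apply Bpoly_derive.
- intros p; apply Bpoly_continuous.
Qed.

(** * From the moment conditions to the push-forward *)

(** The polynomial functions, presented by linear generators so that a property stable under linear
    combinations can be proved by induction. *)
Inductive poly_span : (R -> R) -> Prop :=
| poly_span_pow n : poly_span (fun p => p ^ n)
| poly_span_plus f g : poly_span f -> poly_span g -> poly_span (fun p => f p + g p)
| poly_span_scal c f : poly_span f -> poly_span (fun p => c * f p).

Lemma poly_span_mult (f g : R -> R) :
  poly_span f -> poly_span g -> poly_span (fun p => f p * g p).
Proof.
intros Hf Hg; induction Hf as [n|f1 f2 _ IH1 _ IH2|c f _ IH].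
- induction Hg as [m|g1 g2 _ IH1 _ IH2|c g _ IH].
  + replace (fun p : R => p ^ n * p ^ m) with (fun p => p ^ (n + m)).
    * constructor.
    * apply functional_extensionality; intros p; apply pow_add.
  + replace (fun p : R => p ^ n * (g1 p + g2 p)) with (fun p => p ^ n * g1 p + p ^ n * g2 p).
    * constructor; assumption.
    * apply functional_extensionality; intros p; ring.
  + replace (fun p : R => p ^ n * (c * g p)) with (fun p => c * (p ^ n * g p)).
    * constructor; assumption.
    * apply functional_extensionality; intros p; ring.
- replace (fun p : R => (f1 p + f2 p) * g p) with (fun p => f1 p * g p + f2 p * g p).
  + constructor; assumption.
  + apply functional_extensionality; intros p; ring.
- replace (fun p : R => c * f p * g p) with (fun p => c * (f p * g p)).
  + constructor; assumption.
  + apply functional_extensionality; intros p; ring.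
Qed.

Lemma poly_span_const (c : R) : poly_span (fun _ => c).
Proof.
replace (fun _ : R => c) with (fun p => c * p ^ 0).
- do 2 constructor.
- apply functional_extensionality; intros p; simpl; ring.
Qed.

Lemma poly_span_pow_comp (f : R -> R) (n : nat) : poly_span f -> poly_span (fun p => f p ^ n).
Proof.
intros Hf; induction n as [|n IH]; [apply (poly_span_const 1)|].
apply (poly_span_mult f (fun p => f p ^ n)); assumption.
Qed.

Lemma poly_span_continuous (f : R -> R) : poly_span f -> forall p, continuous f p.
Proof.
intros Hf; induction Hf as [n|f1 f2 _ IH1 _ IH2|c f _ IH]; intros p.
- apply (@ex_derive_continuous _ R_NormedModule); auto_derive; trivial.
- apply (@continuous_plus _ R_AbsRing R_NormedModule); auto.
- apply (@continuous_scal_r _ R_AbsRing R_NormedModule); auto.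
Qed.

(* The leading coefficient of [Bpoly n] is nonzero, so the [Bpoly n] span all polynomials. *)
Lemma Bpoly_span_ind (P : (R -> R) -> Prop) :
  (forall n, P (Bpoly n)) ->
  (forall f g, P f -> P g -> P (fun p => f p + g p)) ->
  (forall c f, P f -> P (fun p => c * f p)) ->
  forall f, poly_span f -> P f.
Proof.
intros HB Hplus Hscal f Hf; induction Hf as [n|f1 f2 _ IH1 _ IH2|c f _ IH]; auto.
induction n as [n IH] using (well_founded_induction lt_wf).
set (c := fun j => (-1) ^ j * sum_multinomial (S j) (S n)).
assert (Hc : c n <> 0).
{ apply Rmult_integral_contrapositive; split; [apply pow_nonzero; lra|apply sum_multinomial_diag]. }
destruct n as [|n].
- replace (fun p : R => p ^ 0) with (Bpoly 0); [apply HB|].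
  apply functional_extensionality; intros p; rewrite Bpoly_0; reflexivity.
(* All terms of [Bpoly (S n)] below the leading one; subtracting them and dividing by the leading
   coefficient isolates the monomial. *)
- assert (L : P (fun p => sum_n (fun j => c j * p ^ j) n)).
  { assert (Hk : forall k, (k < S n)%nat -> P (fun p => sum_n (fun j => c j * p ^ j) k)).
    - induction k as [|k IHk]; intros Hk.
      + replace (fun p : R => sum_n (fun j => c j * p ^ j) 0) with (fun p => c 0%nat * p ^ 0).
        * apply Hscal, IH; lia.
        * apply functional_extensionality; intros p; rewrite sum_O; reflexivity.
      + replace (fun p : R => sum_n (fun j => c j * p ^ j) (S k))
          with (fun p => sum_n (fun j => c j * p ^ j) k + c (S k) * p ^ (S k)).
        * apply Hplus; [apply IHk; lia|apply Hscal, IH; lia].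
        * apply functional_extensionality; intros p; rewrite sum_n_RS; reflexivity.
    - apply Hk; lia. }
  replace (fun p : R => p ^ S n)
    with (fun p => / c (S n) * (Bpoly (S n) p + -1 * sum_n (fun j => c j * p ^ j) n)).
  + apply Hscal, Hplus; [apply HB|apply Hscal, L].
  + apply functional_extensionality; intros p.
    unfold Bpoly; rewrite sum_n_RS; fold (c (S n)).
    change (sum_n (fun j => (-1) ^ j * sum_multinomial (S j) (S (S n)) * p ^ j) n)
      with (sum_n (fun j => c j * p ^ j) n).
    change ((-1) ^ S n * sum_multinomial (S (S n)) (S (S n))) with (c (S n)).
    field; exact Hc.
Qed.

Lemma RInt_Bpoly_0 : RInt (Bpoly 0) 0 1 = 1.
Proof.
rewrite (RInt_ext _ (fun _ => 1)) by (intros; apply Bpoly_0).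
rewrite RInt_const; unfold scal; simpl; unfold mult; simpl; ring.
Qed.

(** The antiderivative [q * (1 - q) * Bpoly n q] vanishes at 0 and at 1. *)
Lemma RInt_Bpoly_S (n : nat) : RInt (Bpoly (S n)) 0 1 = 0.
Proof.
replace 0 with (1 * (1 - 1) * Bpoly n 1 - 0 * (1 - 0) * Bpoly n 0) at 2 by ring.
apply (RInt_FTC (fun q => q * (1 - q) * Bpoly n q)); [lra|intros; apply Bpoly_derive|].
apply (@ex_RInt_continuous R_CompleteNormedModule); intros; apply Bpoly_continuous.
Qed.

Lemma shape_comp_continuous (Psi g : R -> R) (HPsi : shape Psi) (Hg : forall p, continuous g p) (x : R) :
  continuous (fun x => Psi x * (1 - Psi x) * g (Psi x)) x.
Proof.
apply (continuous_mult (fun x => Psi x * (1 - Psi x))).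
- apply (continuous_mult Psi); [apply (shape_continuous _ HPsi)|].
  apply (@continuous_minus _ R_AbsRing R_NormedModule); [apply continuous_const|apply (shape_continuous _ HPsi)].
- apply continuous_comp; [apply (shape_continuous _ HPsi)|apply Hg].
Qed.

Lemma shape_comp_ex_RInt (Psi g : R -> R) (a b : R) :
  shape Psi -> (forall p, continuous g p) ->
  ex_RInt (fun x => Psi x * (1 - Psi x) * g (Psi x)) a b.
Proof.
intros HPsi Hg; apply (@ex_RInt_continuous R_CompleteNormedModule); intros.
apply shape_comp_continuous; assumption.
Qed.

(* The push-forward of [Psi (1 - Psi) dx] under [Psi] is Lebesgue measure on [0, 1]. *)
Lemma Bcoef_pushforward (Psi g : R -> R) :
  shape Psi -> Bcoef Psi 2 = 1 -> (forall n, (2 < n)%nat -> Bcoef Psi n = 0) ->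
  poly_span g ->
  is_lim_seq (fun N => RInt (fun x => Psi x * (1 - Psi x) * g (Psi x)) (- INR N) (INR N))
    (RInt g 0 1).
Proof.
intros HPsi H2 Hn Hg.
(* Continuity is carried through the induction because additivity of the integrals requires
   integrable summands. *)
cut ((forall p, continuous g p) /\
  is_lim_seq (fun N => RInt (fun x => Psi x * (1 - Psi x) * g (Psi x)) (- INR N) (INR N))
    (RInt g 0 1)); [tauto|].
assert (Hex : forall f : R -> R, (forall p, continuous f p) -> ex_RInt f 0 1).
{ intros f Hf; apply (@ex_RInt_continuous R_CompleteNormedModule); auto. }
revert g Hg; apply Bpoly_span_ind.
- intros n; split; [apply Bpoly_continuous|].
  replace (RInt (Bpoly n) 0 1) with (Bcoef Psi (S (S n))); [apply Bcoef_lim; exact HPsi|].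
  destruct n as [|n]; [rewrite RInt_Bpoly_0; exact H2|].
  rewrite RInt_Bpoly_S; apply Hn; lia.
- intros f g [Cf Lf] [Cg Lg]; split.
  + intros p; apply (@continuous_plus _ R_AbsRing R_NormedModule); auto.
  + replace (RInt (fun p => f p + g p) 0 1) with (RInt f 0 1 + RInt g 0 1)
      by (symmetry; apply (RInt_plus (V := R_CompleteNormedModule)); auto).
    eapply is_lim_seq_ext; [|apply is_lim_seq_plus'; [exact Lf|exact Lg]].
    intros N; simpl.
    rewrite <- (RInt_plus (V := R_CompleteNormedModule)) by (apply shape_comp_ex_RInt; assumption).
    apply RInt_ext; intros x _; unfold plus; simpl.
    match goal with |- ?u = ?v => change (u = v :> R) end; ring.
- intros c f [Cf Lf]; split.
  + intros p; apply (@continuous_scal_r _ R_AbsRing R_NormedModule); auto.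
  + replace (RInt (fun p => c * f p) 0 1) with (c * RInt f 0 1)
      by (symmetry; apply (RInt_scal (V := R_CompleteNormedModule)); auto).
    eapply is_lim_seq_ext; [|apply (is_lim_seq_scal_l _ c (RInt f 0 1) Lf)].
    intros N; simpl.
    etransitivity; [symmetry; apply (RInt_scal (V := R_CompleteNormedModule)); apply shape_comp_ex_RInt; assumption|].
    apply RInt_ext; intros x _; unfold scal; simpl; unfold mult; simpl.
    match goal with |- ?u = ?v => change (u = v :> R) end; ring.
Qed.

(** * Polynomial approximation of indicators *)

(* Kuhn's polynomials: as [n] grows they tend to 1 on [u < 1/2] and to 0 on [1/2 < u <= 1]. *)
Definition kuhn (n : nat) (u : R) : R := (1 - u ^ n) ^ (2 ^ n).

Lemma Bernoulli_ineq (x : R) (n : nat) : -1 <= x -> 1 + INR n * x <= (1 + x) ^ n.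
Proof.
intros Hx; induction n as [|n IH]; [simpl; lra|].
rewrite S_INR; simpl; pose proof (pos_INR n); nra.
Qed.

Lemma pow_unit (u : R) (n : nat) : 0 <= u <= 1 -> 0 <= u ^ n <= 1.
Proof.
intros Hu; split; [apply pow_le; lra|rewrite <- (pow1 n); apply pow_incr; lra].
Qed.

Lemma kuhn_unit (n : nat) (u : R) : 0 <= u <= 1 -> 0 <= kuhn n u <= 1.
Proof. intros Hu; apply pow_unit; pose proof (pow_unit u n Hu); lra. Qed.

(** Bernoulli's inequality at [- u ^ n] with exponent [2 ^ n]. *)
Lemma kuhn_lower (n : nat) (u : R) : 0 <= u <= 1 -> 1 - (2 * u) ^ n <= kuhn n u.
Proof.
intros Hu; pose proof (pow_unit u n Hu) as H.
pose proof (Bernoulli_ineq (- u ^ n) (2 ^ n) ltac:(lra)) as B.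
rewrite pow_INR in B; unfold kuhn; rewrite Rpow_mult_distr; simpl INR in B.
replace (1 + 1) with 2 in B by ring.
replace (1 - u ^ n) with (1 + - u ^ n) by ring; lra.
Qed.

(** Bernoulli bounds (2u)^n by (1 + u^n)^(2^n), and (1 - u^n)(1 + u^n) is at most 1. *)
Lemma kuhn_upper (n : nat) (u : R) : 0 <= u <= 1 -> kuhn n u * (2 * u) ^ n <= 1.
Proof.
intros Hu; pose proof (pow_unit u n Hu) as H.
pose proof (Bernoulli_ineq (u ^ n) (2 ^ n) ltac:(lra)) as B.
rewrite pow_INR in B; simpl INR in B; replace (1 + 1) with 2 in B by ring.
pose proof (kuhn_unit n u Hu).
apply Rle_trans with (kuhn n u * (1 + u ^ n) ^ (2 ^ n)).
- apply Rmult_le_compat_l; [lra|]; rewrite Rpow_mult_distr; lra.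
- unfold kuhn; rewrite <- Rpow_mult_distr.
  apply pow_unit; nra.
Qed.

(** The affine change of variable takes [p = c] to the critical value 1/2 and stays in [[0, 1]]
    whenever [c] and [p] do. *)
Definition kuhn_at (c : R) (n : nat) (p : R) : R := kuhn n ((1 + p - c) / 2).

Lemma poly_span_kuhn_at (c : R) (n : nat) : poly_span (kuhn_at c n).
Proof.
unfold kuhn_at, kuhn.
apply (poly_span_pow_comp (fun p => 1 - ((1 + p - c) / 2) ^ n)).
replace (fun p : R => 1 - ((1 + p - c) / 2) ^ n)
  with (fun p : R => 1 + -1 * (((1 - c) / 2 + / 2 * p ^ 1) ^ n)).
- apply (poly_span_plus (fun _ => 1)); [apply poly_span_const|apply poly_span_scal].
  apply (poly_span_pow_comp (fun p => (1 - c) / 2 + / 2 * p ^ 1)).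
  apply (poly_span_plus (fun _ => (1 - c) / 2)); [apply poly_span_const|do 2 constructor].
- apply functional_extensionality; intros p.
  replace ((1 - c) / 2 + / 2 * p ^ 1) with ((1 + p - c) / 2) by (simpl; field); ring.
Qed.

(* [kuhn_at c n] is close to the indicator of [p < c], up to a transition zone of width [2 d]. *)
Lemma kuhn_at_approx (d e : R) : 0 < d <= 1 -> 0 < e ->
  exists n, forall c p, 0 <= c <= 1 -> 0 <= p <= 1 ->
    0 <= kuhn_at c n p <= 1 /\
    (p <= c - d -> 1 - e <= kuhn_at c n p) /\ (c + d <= p -> kuhn_at c n p <= e).
Proof.
intros Hd He.
(* Here [2 * u = 1 + p - c] is at most [1 - d] below the transition zone and at least [1 + d] above
   it, so two geometric sequences decide how large [n] must be. *)
assert (L1 : exists N, forall n, (N <= n)%nat -> (1 - d) ^ n < e).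
{ destruct (pow_lt_1_zero (1 - d) ltac:(rewrite Rabs_pos_eq; lra) e He) as [N HN].
  exists N; intros n Hn; specialize (HN n Hn); rewrite Rabs_pos_eq in HN; [exact HN|].
  apply pow_le; lra. }
assert (L2 : exists N, forall n, (N <= n)%nat -> / e <= (1 + d) ^ n).
{ destruct (Pow_x_infinity (1 + d) ltac:(rewrite Rabs_pos_eq; lra) (/ e)) as [N HN].
  exists N; intros n Hn; specialize (HN n Hn); rewrite Rabs_pos_eq in HN; [lra|].
  apply pow_le; lra. }
destruct L1 as [N1 H1], L2 as [N2 H2].
exists (N1 + N2)%nat; set (n := (N1 + N2)%nat); intros c p Hc Hp.
specialize (H1 n ltac:(lia)); specialize (H2 n ltac:(lia)).
set (u := (1 + p - c) / 2); assert (Hu : 0 <= u <= 1) by (unfold u; lra).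
unfold kuhn_at; fold u; split; [apply kuhn_unit, Hu|split; intros H].
- apply Rle_trans with (1 - (2 * u) ^ n); [|apply kuhn_lower, Hu].
  assert ((2 * u) ^ n <= (1 - d) ^ n) by (apply pow_incr; unfold u; lra); lra.
- pose proof (kuhn_upper n u Hu) as U; pose proof (kuhn_unit n u Hu).
  assert ((1 + d) ^ n <= (2 * u) ^ n) by (apply pow_incr; unfold u; lra).
  assert (Hie : 0 < / e) by (apply Rinv_0_lt_compat, He).
  apply Rmult_le_reg_r with (/ e); [exact Hie|].
  rewrite Rinv_r by lra.
  apply Rle_trans with (2 := U); apply Rmult_le_compat_l; lra.
Qed.

(** Bound [g] by 1 on the outer pieces and by [e] on [[s, t]], of length at most 1. It is used with
    [t = 1] for [kuhn_at] and with [s = 0] for its complement. *)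
Lemma RInt_step_bound (g : R -> R) (s t e : R) :
  (forall p, continuous g p) -> 0 <= s <= t -> t <= 1 -> 0 <= e ->
  (forall p, 0 <= p <= 1 -> g p <= 1) -> (forall p, s <= p <= t -> g p <= e) ->
  RInt g 0 1 <= s + e + (1 - t).
Proof.
intros Hg Hst Ht He H1 H2.
assert (Hex : forall a b, ex_RInt g a b).
{ intros; apply (@ex_RInt_continuous R_CompleteNormedModule); auto. }
assert (C : forall a b m, a <= b -> (forall p, a <= p <= b -> g p <= m) -> RInt g a b <= (b - a) * m).
{ intros a b m Hab Hm.
  replace ((b - a) * m) with (RInt (fun _ => m) a b).
  - apply RInt_le; [exact Hab|auto|apply ex_RInt_const|intros; apply Hm; lra].
  - rewrite RInt_const; reflexivity. }
rewrite <- (RInt_Chasles g 0 s 1), <- (RInt_Chasles g s t 1) by auto.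
pose proof (C 0 s 1 ltac:(lra) ltac:(intros; apply H1; lra)).
pose proof (C s t e ltac:(lra) ltac:(intros; apply H2; lra)).
pose proof (C t 1 1 ltac:(lra) ltac:(intros; apply H1; lra)).
change (RInt g 0 s + (RInt g s t + RInt g t 1) <= s + e + (1 - t)); nra.
Qed.

(** * From the push-forward to the logistic equation *)

Definition pushes_to_Lebesgue (Psi : R -> R) : Prop :=
  forall g, poly_span g ->
  is_lim_seq (fun N => RInt (fun x => Psi x * (1 - Psi x) * g (Psi x)) (- INR N) (INR N))
    (RInt g 0 1).

Section Pushforward.

Variable Psi : R -> R.
Hypothesis HPsi : shape Psi.
Hypothesis Hpush : pushes_to_Lebesgue Psi.

Let h x := Psi x * (1 - Psi x).

Lemma shape_h_ge0 x : 0 <= h x.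
Proof. pose proof (shape_range _ HPsi x); unfold h; nra. Qed.

Lemma shape_h_continuous x : continuous h x.
Proof.
apply (continuous_mult Psi); [apply (shape_continuous _ HPsi)|].
apply (@continuous_minus _ R_AbsRing R_NormedModule); [apply continuous_const|apply (shape_continuous _ HPsi)].
Qed.

Lemma shape_h_ex_RInt a b : ex_RInt h a b.
Proof. apply (@ex_RInt_continuous R_CompleteNormedModule); intros; apply shape_h_continuous. Qed.

(** The integrand is nonnegative, so its integral over [[a, b]] is below those over all large
    [[-N, N]], and these tend to the right side. *)
Lemma pushforward_le (g : R -> R) (a b : R) :
  poly_span g -> (forall p, 0 <= p <= 1 -> 0 <= g p) -> a <= b ->
  RInt (fun x => h x * g (Psi x)) a b <= RInt g 0 1.
Proof.
intros Hg Hpos Hab.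
assert (Hex : forall a b, ex_RInt (fun x => h x * g (Psi x)) a b).
{ intros; apply shape_comp_ex_RInt; [exact HPsi|apply poly_span_continuous, Hg]. }
assert (Hge : forall a b, a <= b -> 0 <= RInt (fun x => h x * g (Psi x)) a b).
{ intros u v Huv; apply RInt_ge_0; [exact Huv|apply Hex|].
  intros x _; apply Rmult_le_pos; [apply shape_h_ge0|apply Hpos, (shape_range _ HPsi)]. }
destruct (nfloor_ex (Rmax 0 (Rmax (- a) b))) as [n [_ Hn]]; [apply Rmax_l|].
pose proof (Rmax_l (- a) b); pose proof (Rmax_r (- a) b); pose proof (Rmax_r 0 (Rmax (- a) b)).
change (Rbar_le (RInt (fun x => h x * g (Psi x)) a b) (RInt g 0 1)).
eapply is_lim_seq_le_loc; [|apply is_lim_seq_const|apply (Hpush g Hg)].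
exists (S n); intros k Hk.
assert (Hk' : INR n + 1 <= INR k) by (rewrite <- S_INR; apply le_INR; exact Hk).
change (RInt (fun x => h x * g (Psi x)) a b <= RInt (fun x => h x * g (Psi x)) (- INR k) (INR k)).
rewrite <- (RInt_Chasles _ (- INR k) a (INR k)), <- (RInt_Chasles _ a b (INR k)) by apply Hex.
pose proof (Hge (- INR k) a ltac:(lra)); pose proof (Hge b (INR k) ltac:(lra)).
unfold plus; simpl; lra.
Qed.

Lemma shape_h_RInt_le_1 a b : a <= b -> RInt h a b <= 1.
Proof.
intros Hab.
apply Rle_trans with (RInt (fun _ => 1) 0 1);
  [|right; rewrite RInt_const; unfold scal; simpl; unfold mult; simpl; ring].
rewrite (RInt_ext h (fun x => h x * (fun _ => 1) (Psi x))) by (intros; simpl; symmetry; apply Rmult_1_r).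
apply (pushforward_le (fun _ => 1)); [apply poly_span_const|intros; lra|exact Hab].
Qed.

(** A Markov-type estimate: [(1 - e) * RInt h a b] is at most the integral of [g], and the missing
    [e * RInt h a b] is at most [e] because the mass is at most 1. *)
Lemma RInt_h_le_of_poly (g : R -> R) (a b e : R) :
  poly_span g -> (forall p, 0 <= p <= 1 -> 0 <= g p) -> a <= b ->
  (forall x, a <= x <= b -> 1 - e <= g (Psi x)) -> 0 <= e ->
  RInt h a b <= RInt g 0 1 + e.
Proof.
intros Hg Hpos Hab Hlow He.
assert (L : (1 - e) * RInt h a b <= RInt g 0 1).
{ apply Rle_trans with (2 := pushforward_le g a b Hg Hpos Hab).
  apply Rle_trans with (RInt (fun x => (1 - e) * h x) a b).
  - right; symmetry; apply (RInt_scal (V := R_CompleteNormedModule)), shape_h_ex_RInt.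
  - apply RInt_le; [exact Hab|apply (@ex_RInt_scal R_NormedModule), shape_h_ex_RInt| |].
    + apply shape_comp_ex_RInt; [exact HPsi|apply poly_span_continuous, Hg].
    + intros x Hx; rewrite Rmult_comm; apply Rmult_le_compat_l; [apply shape_h_ge0|apply Hlow; lra]. }
pose proof (shape_h_RInt_le_1 a b Hab); nra.
Qed.

(** To the right of [x] the values of [Psi] lie in [[0, Psi x]], a set of Lebesgue measure [Psi x];
    its indicator is replaced by [kuhn_at] with threshold slightly above [Psi x]. *)
Lemma RInt_h_le_right x y : x <= y -> RInt h x y <= Psi x.
Proof.
intros Hxy; apply le_epsilon; intros eps Heps.
pose proof (shape_range _ HPsi x) as Hx.
(* The errors add up to [4 * d]: the transition zone costs [2 * d], the values of the polynomial
   above it [d], and their defect from 1 below it [d]. *)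
set (d := Rmin (eps / 4) 1).
assert (Hd : 0 < d <= 1 /\ d <= eps / 4).
{ unfold d; repeat split; [apply Rmin_glb_lt; lra|apply Rmin_r|apply Rmin_l]. }
pose proof (shape_h_RInt_le_1 x y Hxy).
(* If the transition zone reaches 1, the bound of the mass by 1 already suffices. *)
destruct (Rle_dec 1 (Psi x + 2 * d)) as [|Hlt]; [lra|].
destruct (kuhn_at_approx d d) as [n Hn]; [lra|lra|].
set (c := Psi x + d) in *.
assert (Hn' := fun p => Hn c p ltac:(unfold c; lra)); clear Hn.
apply Rle_trans with (RInt (kuhn_at c n) 0 1 + d).
- apply RInt_h_le_of_poly; [apply poly_span_kuhn_at|intros p Hp; apply Hn', Hp|exact Hxy| |lra].
  intros t Ht; apply Hn'; [apply (shape_range _ HPsi)|].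
  pose proof (shape_antitone _ HPsi x t ltac:(lra)); unfold c; lra.
- pose proof (RInt_step_bound (kuhn_at c n) (Psi x + 2 * d) 1 d) as B.
  assert (RInt (kuhn_at c n) 0 1 <= Psi x + 2 * d + d + (1 - 1)); [|lra].
  apply B; try lra.
  + apply poly_span_continuous, poly_span_kuhn_at.
  + intros p Hp; apply Hn', Hp.
  + intros p Hp; apply Hn'; unfold c; lra.
Qed.

Lemma RInt_h_le_left x y : y <= x -> RInt h y x <= 1 - Psi x.
Proof.
intros Hxy; apply le_epsilon; intros eps Heps.
pose proof (shape_range _ HPsi x) as Hx.
set (d := Rmin (eps / 4) 1).
assert (Hd : 0 < d <= 1 /\ d <= eps / 4).
{ unfold d; repeat split; [apply Rmin_glb_lt; lra|apply Rmin_r|apply Rmin_l]. }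
pose proof (shape_h_RInt_le_1 y x Hxy).
destruct (Rle_dec (Psi x) (2 * d)) as [|Hlt]; [lra|].
destruct (kuhn_at_approx d d) as [n Hn]; [lra|lra|].
set (c := Psi x - d) in *.
assert (Hn' := fun p => Hn c p ltac:(unfold c; lra)); clear Hn.
(* To the left of [x] the values lie above [Psi x], so the complementary polynomial is used, with
   threshold just below [Psi x]. *)
set (g := fun p => 1 + -1 * kuhn_at c n p).
assert (Hg : poly_span g).
{ apply (poly_span_plus (fun _ => 1)); [apply poly_span_const|apply poly_span_scal, poly_span_kuhn_at]. }
apply Rle_trans with (RInt g 0 1 + d).
- apply RInt_h_le_of_poly; [exact Hg| |exact Hxy| |lra].
  + intros p Hp; destruct (Hn' p Hp) as [K _]; unfold g; lra.
  + intros t Ht.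
    destruct (Hn' (Psi t) (shape_range _ HPsi t)) as [_ [_ K]].
    pose proof (shape_antitone _ HPsi t x ltac:(lra)).
    specialize (K ltac:(unfold c; lra)); unfold g; lra.
- pose proof (RInt_step_bound g 0 (Psi x - 2 * d) d) as B.
  assert (RInt g 0 1 <= 0 + d + (1 - (Psi x - 2 * d))); [|lra].
  apply B; try lra.
  + apply poly_span_continuous, Hg.
  + intros p Hp; destruct (Hn' p Hp) as [K _]; unfold g; lra.
  + intros p Hp; destruct (Hn' p ltac:(lra)) as [_ [K _]].
    specialize (K ltac:(unfold c; lra)); unfold g; lra.
Qed.

Lemma RInt_h_total : is_lim_seq (fun N => RInt h (- INR N) (INR N)) 1.
Proof.
pose proof (Hpush _ (poly_span_const 1)) as L.
rewrite RInt_const in L; unfold scal in L; simpl in L; unfold mult in L; simpl in L.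
replace ((1 - 0) * 1) with 1 in L by ring.
eapply is_lim_seq_ext; [|exact L].
intros N; apply RInt_ext; intros x _; simpl; apply Rmult_1_r.
Qed.

(** A squeeze: the mass left of [x] is at most [1 - Psi x], and at least the total mass 1 minus the
    bound [Psi x] for the mass on the right. *)
Lemma RInt_h_left_lim x : is_lim_seq (fun N => RInt h (- INR N) x) (1 - Psi x).
Proof.
destruct (nfloor_ex (Rabs x)) as [n [_ Hn]]; [apply Rabs_pos|].
apply is_lim_seq_le_le_loc with (u := fun N => RInt h (- INR N) (INR N) - Psi x) (w := fun _ => 1 - Psi x).
- exists (S n); intros k Hk.
  assert (Hk' : INR n + 1 <= INR k) by (rewrite <- S_INR; apply le_INR; exact Hk).
  pose proof (Rabs_def2 x (INR k) ltac:(lra)) as Hx.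
  split; [|apply RInt_h_le_left; lra].
  rewrite <- (RInt_Chasles h (- INR k) x (INR k)) by apply shape_h_ex_RInt.
  pose proof (RInt_h_le_right x (INR k) ltac:(lra)); unfold plus; simpl; lra.
- apply is_lim_seq_minus'; [apply RInt_h_total|apply is_lim_seq_const].
- apply is_lim_seq_const.
Qed.

Lemma RInt_h_eq x y : RInt h x y = Psi x - Psi y.
Proof.
assert (L : is_lim_seq (fun _ : nat => RInt h x y) (1 - Psi y - (1 - Psi x))).
{ eapply is_lim_seq_ext; [|apply is_lim_seq_minus'; apply RInt_h_left_lim].
  intros N; simpl.
  rewrite <- (RInt_Chasles h (- INR N) x y) by apply shape_h_ex_RInt.
  unfold plus; simpl; ring. }
apply is_lim_seq_unique in L; rewrite Lim_seq_const in L; injection L; lra.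
Qed.

Lemma pushforward_ode x : is_derive Psi x (- (Psi x * (1 - Psi x))).
Proof.
apply is_derive_ext with (fun y => Psi 0 - RInt h 0 y).
{ intros y; rewrite RInt_h_eq; change (Psi 0 - (Psi 0 - Psi y) = Psi y); ring. }
replace (- (Psi x * (1 - Psi x))) with (minus 0 (h x)) by (unfold minus, plus, opp, h; simpl; ring).
apply (@is_derive_minus R_AbsRing R_NormedModule).
- apply (@is_derive_const R_AbsRing R_NormedModule).
- apply (@is_derive_RInt R_CompleteNormedModule) with 0; [|apply shape_h_continuous].
  apply filter_forall; intros y; apply (@RInt_correct R_CompleteNormedModule), shape_h_ex_RInt.
Qed.

End Pushforward.

(** * Solving the logistic equation *)

Lemma shape_lim_right (Psi : R -> R) : shape Psi -> is_lim_seq (fun N => Psi (INR N)) 0.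
Proof. intros HPsi; apply is_lim_seq_0_of_INR_mult, shape_tail_right, HPsi. Qed.

Lemma shape_lim_left (Psi : R -> R) : shape Psi -> is_lim_seq (fun N => 1 - Psi (- INR N)) 0.
Proof.
intros HPsi; apply (is_lim_seq_0_of_INR_mult (fun N => 1 - Psi (- INR N))), shape_tail_left, HPsi.
Qed.

Lemma is_derive_0_const (f : R -> R) : (forall x, is_derive f x 0) -> forall x y, f x = f y.
Proof.
intros Hf x y; destruct (MVT_gen f x y (fun _ => 0)) as [c [_ E]].
- intros; apply Hf.
- intros; apply continuity_pt_filterlim, (@ex_derive_continuous _ R_NormedModule); eexists; apply Hf.
- lra.
Qed.

(** The derivative of [Psi t * exp t] is [Psi t ^ 2 * exp t], so this product is nondecreasing; far
    to the left it is positive since [Psi] tends to 1 there. *)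
Lemma logistic_ode_positive (Psi : R -> R) :
  shape Psi -> (forall x, is_derive Psi x (- (Psi x * (1 - Psi x)))) ->
  forall x, 0 < Psi x.
Proof.
intros HPsi Hode x.
assert (HD : forall y, Derive Psi y = - (Psi y * (1 - Psi y))) by (intros; apply is_derive_unique, Hode).
pose proof (shape_lim_left Psi HPsi) as L; apply is_lim_seq_spec in L.
destruct (L (mkposreal 1 Rlt_0_1)) as [N HN].
destruct (nfloor_ex (Rabs x)) as [n [_ Hn]]; [apply Rabs_pos|].
(* The index exceeds both the rank from which [Psi] is positive on the left and [Rabs x]. *)
specialize (HN (N + S n)%nat ltac:(lia)); simpl in HN; rewrite Rminus_0_r in HN.
set (a := - INR (N + S n)) in *.
assert (Hax : a < x).
{ unfold a; rewrite plus_INR, S_INR; pose proof (pos_INR N).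
  pose proof (Rabs_def2 x (INR n + 1) ltac:(lra)); lra. }
assert (Ha : 0 < Psi a) by (apply Rabs_def2 in HN; lra).
destruct (MVT_gen (fun t => Psi t * exp t) a x (fun t => Psi t ^ 2 * exp t)) as [c [_ E]].
- intros t _; auto_derive; [apply (shape_derivable _ HPsi)|].
  rewrite HD; ring.
- intros t _; apply continuity_pt_filterlim.
  apply (@ex_derive_continuous _ R_NormedModule (fun t => Psi t * exp t)); auto_derive.
  apply (shape_derivable _ HPsi).
- pose proof (exp_pos a); pose proof (exp_pos x); pose proof (exp_pos c).
  assert (0 <= Psi c ^ 2 * exp c) by (apply Rmult_le_pos; [apply pow2_ge_0|lra]).
  assert (0 < Psi a * exp a) by (apply Rmult_lt_0_compat; assumption).
  assert (0 <= Psi c ^ 2 * exp c * (x - a)) by (apply Rmult_le_pos; lra).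
  apply Rmult_lt_reg_r with (exp x); [assumption|]; lra.
Qed.

Lemma logistic_ode_MNS (Psi : R -> R) :
  shape Psi -> (forall x, is_derive Psi x (- (Psi x * (1 - Psi x)))) ->
  exists a, forall t, Psi t = MNS (t - a).
Proof.
intros HPsi Hode.
assert (Hpos := logistic_ode_positive Psi HPsi Hode).
assert (HD : forall y, Derive Psi y = - (Psi y * (1 - Psi y))) by (intros; apply is_derive_unique, Hode).
(* A first integral of the equation; for the translate of [MNS] by [a] it equals [exp (- a)], whence
   the witness [- ln (K 0)] below. *)
set (K := fun t => (1 - Psi t) / Psi t * exp (- t)).
assert (HK : forall x y, K x = K y).
{ apply is_derive_0_const; intros x; unfold K; pose proof (Hpos x).
  auto_derive.
  - repeat split; try apply (shape_derivable _ HPsi); lra.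
  - rewrite HD; field; lra. }
assert (HE : forall t, (1 - Psi t) = K 0 * exp t * Psi t).
{ intros t; rewrite (HK 0 t); unfold K; rewrite exp_Ropp; pose proof (exp_pos t); pose proof (Hpos t).
  field; lra. }
(* The limit 0 at the right end yields a point where [Psi] is less than 1. *)
assert (HK0 : 0 < K 0).
{ pose proof (shape_lim_right Psi HPsi) as L; apply is_lim_seq_spec in L.
  destruct (L (mkposreal 1 Rlt_0_1)) as [N HN].
  specialize (HN N (Nat.le_refl N)); simpl in HN; rewrite Rminus_0_r in HN; apply Rabs_def2 in HN.
  specialize (HE (INR N)); specialize (Hpos (INR N)); pose proof (exp_pos (INR N)).
  assert (0 < exp (INR N) * Psi (INR N)) by (apply Rmult_lt_0_compat; assumption).
  nra. }
exists (- ln (K 0)); intros t; unfold MNS.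
replace (t - - ln (K 0)) with (ln (K 0) + t) by ring.
rewrite exp_plus, exp_ln by exact HK0.
specialize (HE t); assert (0 < K 0 * exp t) by (apply Rmult_lt_0_compat; [exact HK0|apply exp_pos]).
apply Rmult_eq_reg_r with (1 + K 0 * exp t); [|lra].
replace (1 / (1 + K 0 * exp t) * (1 + K 0 * exp t)) with 1 by (field; lra); lra.
Qed.

(** * The MNS shape and its translates *)

Lemma MNS_is_derive (a x : R) : is_derive (fun t => MNS (t - a)) x (- (MNS (x - a) * (1 - MNS (x - a)))).
Proof.
unfold MNS; pose proof (exp_pos (x - a)).
auto_derive; change (x + - a) with (x - a); [lra|field; lra].
Qed.

Lemma MNS_is_derive_0 (x : R) : is_derive MNS x (- (MNS x * (1 - MNS x))).
Proof.
pose proof (MNS_is_derive 0 x) as H; rewrite Rminus_0_r in H.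
revert H; apply is_derive_ext; intros t; rewrite Rminus_0_r; reflexivity.
Qed.

Lemma MNS_range x : 0 < MNS x < 1.
Proof.
unfold MNS; pose proof (exp_pos x); split; [apply Rdiv_lt_0_compat; lra|].
apply Rlt_div_l; lra.
Qed.

Lemma MNS_opp x : MNS (- x) = 1 - MNS x.
Proof.
unfold MNS; rewrite exp_Ropp; pose proof (exp_pos x); field; lra.
Qed.

Lemma MNS_continuous x : continuous MNS x.
Proof. apply (@ex_derive_continuous _ R_NormedModule); eexists; apply MNS_is_derive_0. Qed.

Lemma MNS_le_exp x : MNS x <= exp (- x).
Proof.
unfold MNS; rewrite exp_Ropp; pose proof (exp_pos x).
unfold Rdiv; rewrite Rmult_1_l; apply Rinv_le_contravar; lra.
Qed.

Lemma MNS_Derive x : Derive MNS x = - (MNS x * (1 - MNS x)).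
Proof. apply is_derive_unique, MNS_is_derive_0. Qed.

Lemma MNS_lim_p : filterlim MNS (Rbar_locally p_infty) (locally 0).
Proof.
apply (is_lim_le_le_loc (fun _ => 0) (fun x => exp (- x)) MNS p_infty 0).
- exists 0; intros x _; pose proof (MNS_range x); split; [lra|apply MNS_le_exp].
- apply is_lim_const.
- apply is_lim_comp with m_infty; [apply is_lim_exp_m|apply (is_lim_opp _ p_infty p_infty), is_lim_id|].
  exists 0; intros; discriminate.
Qed.

Lemma MNS_lim_m : filterlim MNS (Rbar_locally m_infty) (locally 1).
Proof.
apply (is_lim_ext (fun x => 1 - MNS (- x)) MNS m_infty 1); [intros x; rewrite MNS_opp; ring|].
replace (Finite 1) with (Finite (1 - 0)) by (f_equal; ring).
apply (is_lim_minus' (fun _ => 1) (fun x => MNS (- x)) m_infty 1 0); [apply is_lim_const|].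
apply (filterlim_comp _ _ _ Ropp MNS (Rbar_locally m_infty) (Rbar_locally p_infty));
  [apply filterlim_opp_m|apply MNS_lim_p].
Qed.

Lemma shape_MNS : shape MNS.
Proof.
assert (L1 : ex_RInt_gen MNS (at_point 0) (Rbar_locally p_infty)).
{ assert (Hex : forall b, ex_RInt MNS 0 b).
  { intros b; apply (@ex_RInt_continuous R_CompleteNormedModule); intros; apply MNS_continuous. }
  apply ex_RInt_gen_pos_bounded with 1; [auto|intros; apply Rlt_le, MNS_range|].
  intros b Hb.
  assert (He : is_RInt (fun x => exp (- x)) 0 b (- exp (- b) - - exp (- 0))).
  { apply (is_RInt_derive (fun x => - exp (- x))).
    - intros; auto_derive; [trivial|ring].
    - intros; apply (@ex_derive_continuous _ R_NormedModule); auto_derive; trivial. }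
  apply Rle_trans with (RInt (fun x => exp (- x)) 0 b).
  - apply RInt_le; [exact Hb|auto|eexists; exact He|intros; apply MNS_le_exp].
  - rewrite (is_RInt_unique _ _ _ _ He), Ropp_0, exp_0; pose proof (exp_pos (- b)); lra. }
split.
- intros x; pose proof (MNS_range x); lra.
- intros x; eexists; apply MNS_is_derive_0.
- intros x; rewrite MNS_Derive; pose proof (MNS_range x); nra.
(* The limit of [MNS] at [p_infty] minus its limit at [m_infty]. *)
- exists (0 - 1); unfold is_RInt_line.
  apply is_RInt_gen_Derive; [| |apply MNS_lim_m|apply MNS_lim_p]; apply filter_forall; intros ab x _.
  + eexists; apply MNS_is_derive_0.
  + apply continuous_ext with (fun x => - (MNS x * (1 - MNS x))); [intros; rewrite MNS_Derive; reflexivity|].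
    apply (@continuous_opp _ R_AbsRing R_NormedModule), (continuous_mult MNS); [apply MNS_continuous|].
    apply (@continuous_minus _ R_AbsRing R_NormedModule); [apply continuous_const|apply MNS_continuous].
- exact L1.
- apply ex_RInt_gen_ext with (fun x => MNS (- x)).
  + apply filter_forall; intros ab x _; apply MNS_opp.
  + apply ex_RInt_gen_opp_left, L1.
Qed.

(** Under the equation, [Psi (1 - Psi) dx] is [- d Psi]: substituting [p = Psi x] gives the integral
    of [Bpoly n] from [Psi (INR N)] to [Psi (- INR N)], and these endpoints tend to 0 and 1. *)
Lemma Bcoef_logistic (Psi : R -> R) (n : nat) :
  shape Psi -> (forall x, is_derive Psi x (- (Psi x * (1 - Psi x)))) ->
  Bcoef Psi (S (S n)) = RInt (Bpoly n) 0 1.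
Proof.
intros HPsi Hode.
set (F := fun p => RInt (Bpoly n) 0 p).
assert (HF : forall p, is_derive F p (Bpoly n p)).
{ intros p; apply (@is_derive_RInt R_CompleteNormedModule) with 0; [|apply Bpoly_continuous].
  apply filter_forall; intros y; apply (@RInt_correct R_CompleteNormedModule).
  apply (@ex_RInt_continuous R_CompleteNormedModule); intros; apply Bpoly_continuous. }
assert (E : forall N, RInt (fun x => Psi x * (1 - Psi x) * Bpoly n (Psi x)) (- INR N) (INR N) =
  F (Psi (- INR N)) - F (Psi (INR N))).
{ intros N.
  replace (F (Psi (- INR N)) - F (Psi (INR N))) with (- F (Psi (INR N)) - - F (Psi (- INR N))) by ring.
  apply (RInt_FTC (fun x => - F (Psi x))); [apply INR_interval| |].
  - intros x.
    replace (Psi x * (1 - Psi x) * Bpoly n (Psi x)) with (- (- (Psi x * (1 - Psi x)) * Bpoly n (Psi x))) by ring.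
    apply (@is_derive_opp _ R_NormedModule), (is_derive_comp F Psi); [apply HF|apply Hode].
  - apply shape_comp_ex_RInt; [exact HPsi|apply Bpoly_continuous]. }
assert (Fc : forall p, continuity_pt F p).
{ intros p; apply continuity_pt_filterlim, (@ex_derive_continuous _ R_NormedModule); eexists; apply HF. }
assert (L : is_lim_seq (fun N => F (Psi (- INR N)) - F (Psi (INR N))) (F 1 - F 0)).
{ apply is_lim_seq_minus'; apply (is_lim_seq_continuous F); try apply Fc.
  - apply is_lim_seq_ext with (fun N => 1 - (1 - Psi (- INR N))); [intros; ring|].
    replace (Finite 1) with (Finite (1 - 0)) by (f_equal; ring).
    apply is_lim_seq_minus'; [apply is_lim_seq_const|apply shape_lim_left, HPsi].
  - apply shape_lim_right, HPsi. }
assert (L' := is_lim_seq_ext _ _ _ E (Bcoef_lim Psi n HPsi)).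
apply is_lim_seq_unique in L; apply is_lim_seq_unique in L'.
rewrite L in L'; apply (f_equal real) in L'; change (F 1 - F 0 = Bcoef Psi (S (S n))) in L'.
rewrite <- L'; unfold F; rewrite RInt_point; unfold zero; simpl; apply Rminus_0_r.
Qed.

Lemma Bcoef_MNS_shift (Psi : R -> R) (a : R) :
  shape Psi -> (forall t, Psi t = MNS (t - a)) ->
  Bcoef Psi 2 = 1 /\ forall n, (2 < n)%nat -> Bcoef Psi n = 0.
Proof.
intros HPsi Ha.
assert (Hode : forall x, is_derive Psi x (- (Psi x * (1 - Psi x)))).
{ intros x; rewrite Ha; generalize (MNS_is_derive a x); apply is_derive_ext; intros; symmetry; apply Ha. }
split.
- rewrite Bcoef_logistic by assumption; apply RInt_Bpoly_0.
- intros [|[|[|n]]] Hn; try lia; rewrite Bcoef_logistic by assumption; apply RInt_Bpoly_S.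
Qed.

(** By parts, the truncated mean is the integral of [Psi] over [[-N, N]] up to boundary terms, and
    [t - ln (1 + exp (t - a))] is an explicit antiderivative of [Psi]. *)
Lemma mean_MNS_shift (Psi : R -> R) (a : R) :
  shape Psi -> (forall t, Psi t = MNS (t - a)) -> mean Psi = a.
Proof.
intros HPsi Ha.
assert (L : is_lim_seq (fun N => RInt (fun x => x * density Psi x * 1) (- INR N) (INR N)) (mean Psi)).
{ pose proof (is_lim_seq_RInt_line Psi 0 0 HPsi) as L.
  replace (mean Psi) with (RInt_line (fun x => x * density Psi x * (Psi x ^ 0 * (1 - Psi x) ^ 0))).
  - eapply is_lim_seq_ext; [|exact L].
    intros N; apply RInt_ext; intros x _; simpl.
    match goal with |- ?u = ?v => change (u = v :> R) end; ring.
  - unfold mean; f_equal; apply functional_extensionality; intros x; simpl; ring. }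
assert (Ei : forall N, RInt Psi (- INR N) (INR N) =
  INR N + a - ln (1 + exp (a - INR N)) + ln (1 + exp (- a - INR N))).
{ intros N; set (G := fun t => t - ln (1 + exp (t - a))).
  assert (E : RInt Psi (- INR N) (INR N) = G (INR N) - G (- INR N)).
  { apply RInt_FTC; [apply INR_interval| |].
    - intros x; rewrite Ha; unfold G, MNS; pose proof (exp_pos (x - a)).
      change (is_derive (fun t => t - ln (1 + exp (t - a))) (x : R) (1 / (1 + exp (x - a)))).
      auto_derive; change (x + - a) with (x - a); [lra|field; lra].
    - apply (@ex_RInt_continuous R_CompleteNormedModule); intros; apply (shape_continuous _ HPsi). }
  rewrite E; unfold G.
  replace (- INR N - a) with (- a - INR N) by ring.
  (* Factoring out the growing exponential isolates the linear part; the logarithms that remain tend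
     to 0. *)
  replace (1 + exp (INR N - a)) with (exp (INR N - a) * (1 + exp (a - INR N))).
  - pose proof (exp_pos (a - INR N)); rewrite ln_mult, ln_exp by (try apply exp_pos; lra).
    match goal with |- ?u = ?v => change (u = v :> R) end; ring.
  - rewrite Rmult_plus_distr_l, <- exp_plus.
    replace (INR N - a + (a - INR N)) with 0 by ring; rewrite exp_0; ring. }
assert (Le : forall c, is_lim_seq (fun N => ln (1 + exp (c - INR N))) 0).
{ intros c; replace (Finite 0) with (Finite (ln (1 + 0))) by (rewrite Rplus_0_r, ln_1; reflexivity).
  apply (is_lim_seq_continuous ln (fun N => 1 + exp (c - INR N))).
  - apply continuity_pt_filterlim, (@ex_derive_continuous _ R_NormedModule ln); auto_derive; lra.
  - apply is_lim_seq_plus'; [apply is_lim_seq_const|].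
    apply (filterlim_comp _ _ _ (fun N => c - INR N) exp eventually (Rbar_locally m_infty)).
    + apply (is_lim_seq_minus (fun _ => c) INR c p_infty m_infty);
        [apply is_lim_seq_const|apply is_lim_seq_INR|reflexivity].
    + apply is_lim_exp_m. }
assert (L2 : is_lim_seq (fun N => RInt (fun x => x * density Psi x * 1) (- INR N) (INR N)) a).
{ apply is_lim_seq_ext with (fun N => INR N * (1 - Psi (- INR N)) - INR N * Psi (INR N) + a
    - ln (1 + exp (a - INR N)) + ln (1 + exp (- a - INR N))).
  - intros N; rewrite (RInt_x_density Psi (fun p => p) (fun _ => 1)); auto.
    + change (RInt (fun x => Psi x) (- INR N) (INR N)) with (RInt Psi (- INR N) (INR N)).
      rewrite Ei; ring.
    + apply INR_interval.
    + intros; apply (@is_derive_id R_AbsRing).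
    + intros; apply continuous_const.
  - replace (Finite a) with (Finite (0 - 0 + a - 0 + 0)) by (f_equal; ring).
    apply is_lim_seq_plus'; [apply is_lim_seq_minus'; [apply is_lim_seq_plus'; [apply is_lim_seq_minus'|]|]|].
    + apply shape_tail_left, HPsi.
    + apply shape_tail_right, HPsi.
    + apply is_lim_seq_const.
    + apply Le.
    + apply Le. }
apply is_lim_seq_unique in L; apply is_lim_seq_unique in L2.
rewrite L in L2; injection L2; auto.
Qed.

Lemma Bcoef_eq0_iff (Psi : R -> R) :
  shape Psi -> Bcoef Psi 2 = 1 ->
  ((forall n : nat, (2 < n)%nat -> Bcoef Psi n = 0) <->
   (exists a : R, forall t : R, Psi t = MNS (t - a))).
Proof.
intros HPsi H2; split.
- intros Hn; apply logistic_ode_MNS; [exact HPsi|].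
  apply pushforward_ode; [exact HPsi|].
  intros g Hg; apply Bcoef_pushforward; assumption.
- intros [a Ha]; apply (Bcoef_MNS_shift Psi a HPsi Ha).
Qed.

Theorem proposition1p9 :
  (shape MNS /\ Bcoef MNS 2 = 1 /\
   (forall n : nat, (2 < n)%nat -> Bcoef MNS n = 0)) /\
  (forall Psi : R -> R, shape Psi -> Bcoef Psi 2 = 1 ->
     ((forall n : nat, (2 < n)%nat -> Bcoef Psi n = 0) <->
      (exists a : R, forall t : R, Psi t = MNS (t - a)))) /\
  (forall Psi : R -> R, shape Psi -> Bcoef Psi 2 = 1 -> mean Psi = 0 ->
     ((forall n : nat, (2 < n)%nat -> Bcoef Psi n = 0) <->
      (forall t : R, Psi t = MNS t))).
Proof.
assert (Z : forall t, MNS t = MNS (t - 0)) by (intros; rewrite Rminus_0_r; reflexivity).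
split; [|split].
- split; [apply shape_MNS|apply (Bcoef_MNS_shift MNS 0 shape_MNS Z)].
- apply Bcoef_eq0_iff.
- intros Psi HPsi H2 Hm; rewrite (Bcoef_eq0_iff Psi HPsi H2); split.
  + intros [a Ha] t.
    assert (a = 0) by (rewrite <- Hm; symmetry; apply mean_MNS_shift; assumption).
    subst a; rewrite Ha, Z; f_equal; ring.
  + intros H; exists 0; intros t; rewrite H; apply Z.
Qed.
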